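(* Let $\alpha>0$, $L=2\pi/\alpha$, and let $\{\phi_n\}_{n=1}^N$ be an orthonormal family of $L$-periodic vector functions $\phi_n(x)=(\phi_n(x,1),\dots,\phi_n(x,M))^T$ with $\phi_n(\cdot,j)\in H^1(0,L)_{\mathrm{per}}$ for all $n,j$. Let $U(x,y)=\sum_{n=1}^N\phi_n(x)\overline{\phi_n(y)}^T$ (an $M\times M$ matrix). Then for every $\beta>0$ $$\int_0^{L}\operatorname{Tr}[U(x,x)^{3}]\,dx\le K_1(\beta)^2\sum_{n=1}^N\sum_{j=1}^M\int_0^{L}\bigl(|\phi'_n(x,j)|^2+\alpha^2\beta|\phi_n(x,j)|^2\bigr)dx.$$ If $\alpha=1$, $L=2\pi$, and $\int_0^{2\pi}\phi_n(x,j)\,dx=0$ for all $n$ and $j$, then for every $\beta\in[0,1)$ $$\int_0^{2\pi}\operatorname{Tr}[U(x,x)^{3}]\,dx\le K_2(\beta)^2\sum_{n=1}^N\sum_{j=1}^M\int_0^{2\pi}\bigl(|\phi'_n(x,j)|^2-\beta|\phi_n(x,j)|^2\bigr)dx.$$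
   Context: Orthonormality means $\sum_{j=1}^M\int_0^L\phi_n(x,j)\overline{\phi_m(x,j)}\,dx=\delta_{nm}$ (functions are complex-valued). $K_1(\beta)$, $\beta>0$, is the smallest constant such that $$\|u\|_\infty^2\le K_1(\beta)\Bigl(\int_0^{2\pi/\alpha}(u'(x)^2+\alpha^2\beta u(x)^2)dx\Bigr)^{1/2}\Bigl(\int_0^{2\pi/\alpha}u(x)^2dx\Bigr)^{1/2}$$ for all real $2\pi/\alpha$-periodic $u\in H^1$ (it does not depend on $\alpha$; $K_1(\beta)=\sup_{\lambda>0}\sqrt{\lambda}\,\frac{\coth(\pi\sqrt{\beta+\lambda})}{\sqrt{\beta+\lambda}}$). $K_2(\beta)$, $0\le\beta<1$, is the smallest constant such that $$\|u\|_\infty^2\le K_2(\beta)\Bigl(\int_0^{2\pi}(u'(x)^2-\beta u(x)^2)dx\Bigr)^{1/2}\Bigl(\int_0^{2\pi}u(x)^2dx\Bigr)^{1/2}$$ for all real $2\pi$-periodic $u\in H^1$ with $\int_0^{2\pi}u\,dx=0$ (equivalently $K_2(\beta)=\sup_{\lambda>0}\frac{\sqrt\lambda}{\pi}\sum_{k\in\mathbb{Z}\setminus\{0\}}\frac1{k^2-\beta+\lambda}$). *)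

(* Defs.v *)
From HB Require Import structures.
From mathcomp Require Import all_boot all_order all_algebra.
From mathcomp Require Import complex.
From mathcomp Require Import all_classical all_reals all_analysis.

Set Implicit Arguments.
Unset Strict Implicit.
Unset Printing Implicit Defensive.

Import Order.TTheory GRing.Theory Num.Theory.
Import numFieldNormedType.Exports.

Local Open Scope classical_set_scope.
Local Open Scope ring_scope.

Section Defs.
Variable R : realType.
Local Notation mu := (@lebesgue_measure R).

(* [H1per L u du]: the real function [u] belongs to H^1(0, L)_per and [du] is
   its weak derivative on [0, L].  As usual in dimension one, [u] is identified
   with its absolutely continuous representative, i.e. with the primitive of
   its weak derivative, and is extended L-periodically to the line. *)
Definition H1per (L : R) (u du : R -> R) : Prop :=
  [/\ measurable_fun `[0, L] du,
      mu.-integrable `[0, L] (fun x => (du x ^+ 2)%:E),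
      forall x, x \in `[0, L] -> u x = u 0 + \int[mu]_(t in `[0, x]) du t
    & forall x, u (x + L) = u x].

Definition H1perC (L : R) (f df : R -> R[i]) : Prop :=
  H1per L (fun x => complex.Re (f x)) (fun x => complex.Re (df x)) /\
  H1per L (fun x => complex.Im (f x)) (fun x => complex.Im (df x)).

Definition cintegral (D : set R) (f : R -> R[i]) : R[i] :=
  Complex (\int[mu]_(x in D) complex.Re (f x))
          (\int[mu]_(x in D) complex.Im (f x)).

(* Elements of H^1 are represented by continuous functions, for which the
   L^oo norm is the supremum over a period. *)
Definition supnorm (L : R) (u : R -> R) : R :=
  sup [set `|u x| | x in `[0, L]].

(* Since the smallest constant for 2 pi / alpha-periodic functions does not
   depend on alpha, it is the smallest constant valid for all alpha > 0. *)
Definition K1 (beta : R) : R :=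
  inf [set K : R | forall (alpha : R) (u du : R -> R),
    0 < alpha -> H1per (2 * pi / alpha) u du ->
    supnorm (2 * pi / alpha) u ^+ 2 <=
      K * Num.sqrt (\int[mu]_(x in `[0, 2 * pi / alpha])
                      (du x ^+ 2 + alpha ^+ 2 * beta * u x ^+ 2))
        * Num.sqrt (\int[mu]_(x in `[0, 2 * pi / alpha]) (u x ^+ 2))].

Definition K2 (beta : R) : R :=
  inf [set K : R | forall u du : R -> R,
    H1per (2 * pi) u du -> \int[mu]_(x in `[0, 2 * pi]) u x = 0 ->
    supnorm (2 * pi) u ^+ 2 <=
      K * Num.sqrt (\int[mu]_(x in `[0, 2 * pi]) (du x ^+ 2 - beta * u x ^+ 2))
        * Num.sqrt (\int[mu]_(x in `[0, 2 * pi]) (u x ^+ 2))].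

Definition orthonormal_family (N M : nat) (L : R)
    (phi : 'I_N -> R -> 'cV[R[i]]_M) : Prop :=
  forall n m : 'I_N,
    \sum_(j < M) cintegral `[0, L] (fun x => phi n x j 0 * (phi m x j 0)^*%C)
    = (n == m)%:R.

Definition Umx (N M : nat) (phi : 'I_N -> R -> 'cV[R[i]]_M) (x y : R) :
    'M[R[i]]_M :=
  \sum_(n < N) phi n x *m (map_mx (@conjc R) (phi n y))^T.

End Defs.

(* Main.v *)
(* Let [A(x)] be the [N x N] matrix with entries [sum_j phi_n(x,j) conj(phi_m(x,j))], so that
   [Tr U(x,x)^3 = Tr A(x)^3] and, by orthonormality, [int A(x) dx = 1].  A row vector [xi] gives
   the vector function [psi = sum_n xi_n phi_n]; the scalar inequality defining [K1] (or [K2])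
   applied to the real and imaginary parts of each component of [psi], followed by Cauchy-Schwarz
   over the components, reads
     [<A(x) xi, xi>^2 <= K^2 <E xi, xi> <xi, xi>],
   where [E] is the matrix of the energy form on the family.  In an orthonormal eigenbasis of
   [A(x)], multiplying by the eigenvalue and summing gives [Tr A(x)^3 <= K^2 Tr (A(x) E)], and
   integrating in [x] gives [K^2 Tr E].
   Since [inf] of an empty set is [0], it has to be shown that some finite constant is admissible
   in the definitions of [K1] and [K2].  For [K2] with [beta] close to [1] this requires the
   Wirtinger inequality with its sharp constant, obtained here without Fourier series: a Schur
   test with weights [sin] and [cos] on quarter periods, at one end of which the function minus
   its common value at two antipodal points vanishes. *)

Require Import Defs.
From HB Require Import structures.
From mathcomp Require Import all_boot all_order all_algebra.
From mathcomp Require Import complex.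
From mathcomp Require Import all_classical all_reals all_analysis.
From mathcomp Require Import measurable_realfun ring lra.

Set Implicit Arguments.
Unset Strict Implicit.
Unset Printing Implicit Defensive.

Import Order.TTheory GRing.Theory Num.Theory.
Import numFieldNormedType.Exports.

Local Open Scope classical_set_scope.
Local Open Scope ring_scope.

Lemma le_inf_mul (R : realType) (S : set R) (x y : R) :
  S !=set0 -> 0 <= y -> (forall K, S K -> x <= K * y) -> x <= inf S * y.
Proof.
move=> S0; rewrite le_eqVlt => /predU1P[<- h|y0 h].
  by case: S0 => K /h; rewrite !mulr0.
rewrite -ler_pdivrMr//; apply: lb_le_inf => // K SK.
by rewrite ler_pdivrMr// h.
Qed.

Lemma sqr_le_mul_of_quadratic (R : realFieldType) (a b c : R) :
  0 <= a -> (forall t, 0 <= a * t ^+ 2 + 2 * b * t + c) -> b ^+ 2 <= a * c.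
Proof.
rewrite le_eqVlt => /predU1P[<- h|a0 h].
  rewrite mul0r; have [->|b0] := eqVneq b 0; first by rewrite expr0n.
  have := h (- (c + 1) / (2 * b)).
  have -> : 0 * (- (c + 1) / (2 * b)) ^+ 2 + 2 * b * (- (c + 1) / (2 * b)) + c = -1.
    by field; rewrite b0.
  by rewrite ler0N1.
have := h (- b / a).
have -> : a * (- b / a) ^+ 2 + 2 * b * (- b / a) + c = (a * c - b ^+ 2) / a.
  by field; rewrite gt_eqF.
by rewrite pmulr_lge0 ?invr_gt0// subr_ge0.
Qed.

Section Rint.
Context d (T : measurableType d) (R : realType) (mu : {measure set T -> \bar R}).
Context (D : set T) (mD : measurable D).

Lemma integrable_scale (f : T -> R) (k : R) :
  mu.-integrable D (EFin \o f) -> mu.-integrable D (fun x => (k * f x)%:E).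
Proof. by move=> h; apply: eq_integrable (integrableZl mD k h). Qed.

Lemma integrable_add (f g : T -> R) :
  mu.-integrable D (EFin \o f) -> mu.-integrable D (EFin \o g) ->
  mu.-integrable D (fun x => (f x + g x)%:E).
Proof. by move=> h k; apply: eq_integrable (integrableD mD h k). Qed.

Lemma integrable_mul_L2 (f g : T -> R) :
  measurable_fun D f -> measurable_fun D g ->
  mu.-integrable D (fun x => (f x ^+ 2)%:E) ->
  mu.-integrable D (fun x => (g x ^+ 2)%:E) ->
  mu.-integrable D (fun x => (f x * g x)%:E).
Proof.
move=> mf mg f2 g2; apply: le_integrable (integrable_add f2 g2) => //.
  by apply/measurable_EFinP; exact: measurable_funM.
move=> x Dx; rewrite /= lee_fin normrM.
rewrite [leRHS]ger0_norm ?addr_ge0 ?sqr_ge0// -(real_normK (num_real (f x))).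
rewrite -(real_normK (num_real (g x))).
have := sqr_ge0 (`|f x| - `|g x|); have := normr_ge0 (f x); have := normr_ge0 (g x).
by move: `|f x| `|g x| => a b; nra.
Qed.

Lemma integrable_of_L2 (f : T -> R) : (mu D < +oo)%E ->
  measurable_fun D f -> mu.-integrable D (fun x => (f x ^+ 2)%:E) ->
  mu.-integrable D (EFin \o f).
Proof.
move=> Doo mf f2.
have i1 : mu.-integrable D (fun x => (1 ^+ 2 : R)%:E).
  by apply: (@measurable_bounded_integrable _ _ _ mu (cst (1 ^+ 2))) => //; exact: bounded_cst.
have := integrable_mul_L2 mf (measurable_cst (1 : R)) f2 i1.
by apply: eq_integrable => // x _ /=; rewrite mulr1.
Qed.

Lemma cauchy_schwarz_Rintegral (f g : T -> R) :
  measurable_fun D f -> measurable_fun D g ->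
  mu.-integrable D (fun x => (f x ^+ 2)%:E) ->
  mu.-integrable D (fun x => (g x ^+ 2)%:E) ->
  (\int[mu]_(x in D) (f x * g x)) ^+ 2 <=
    \int[mu]_(x in D) (f x ^+ 2) * \int[mu]_(x in D) (g x ^+ 2).
Proof.
move=> mf mg f2 g2; have fg := integrable_mul_L2 mf mg f2 g2.
apply: sqr_le_mul_of_quadratic => [|t].
  by apply: Rintegral_ge0 => x _; exact: sqr_ge0.
have -> : \int[mu]_(x in D) (f x ^+ 2) * t ^+ 2 + 2 * \int[mu]_(x in D) (f x * g x) * t
    + \int[mu]_(x in D) (g x ^+ 2) =
    \int[mu]_(x in D) (t ^+ 2 * f x ^+ 2 + (2 * t) * (f x * g x) + g x ^+ 2).
  rewrite !RintegralD ?RintegralZl//; first by ring.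
  all: repeat first [exact: integrable_scale | exact: integrable_add | apply: integrable_add].
apply: Rintegral_ge0 => x _.
have -> : t ^+ 2 * f x ^+ 2 + 2 * t * (f x * g x) + g x ^+ 2 = (t * f x + g x) ^+ 2 by ring.
exact: sqr_ge0.
Qed.

End Rint.

(** * Periodic H^1 functions and a crude Sobolev inequality *)

Section H1per.
Context (R : realType).
Notation mu := (@lebesgue_measure R).
Implicit Types (L : R) (u v du dv : R -> R).

Lemma lebesgue_itv_lty (a b : R) : (mu `[a, b] < +oo)%E.
Proof. by rewrite lebesgue_measure_itv/=; case: ifP => // _; rewrite ltry. Qed.

Lemma H1per_measurable L u du : H1per L u du -> measurable_fun `[0, L] du.
Proof. by case. Qed.

Lemma H1per_L2 L u du : H1per L u du -> mu.-integrable `[0, L] (fun x => (du x ^+ 2)%:E).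
Proof. by case. Qed.

Lemma H1per_integrable L u du : H1per L u du -> mu.-integrable `[0, L] (EFin \o du).
Proof. by case=> m i _ _; apply: integrable_of_L2 => //; exact: lebesgue_itv_lty. Qed.

Lemma sub_itv_cc (a b c d : R) : a <= c -> d <= b -> `[c, d]%classic `<=` `[a, b]%classic.
Proof. by move=> ac db; apply: subset_itv; rewrite bnd_simp. Qed.

Lemma integrable_itvS (a b c d : R) (f : R -> R) : a <= c -> d <= b ->
  mu.-integrable `[a, b] (EFin \o f) -> mu.-integrable `[c, d] (EFin \o f).
Proof. by move=> ac db; apply: integrableS => //; exact: sub_itv_cc. Qed.

Lemma measurable_itvS (a b c d : R) (f : R -> R) : a <= c -> d <= b ->
  measurable_fun `[a, b] f -> measurable_fun `[c, d] f.
Proof. by move=> ac db; apply: measurable_funS => //; exact: sub_itv_cc. Qed.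

Lemma Rintegral_itv_split (a b c : R) (f : R -> R) : a <= b -> b <= c ->
  mu.-integrable `[a, c] (EFin \o f) ->
  \int[mu]_(t in `[a, c]) f t = \int[mu]_(t in `[a, b]) f t + \int[mu]_(t in `[b, c]) f t.
Proof.
move=> ab bc i.
have := @Rintegral_itvB R f (BLeft a) (BRight c) b i.
rewrite !bnd_simp => /(_ ab bc) /eqP; rewrite subr_eq => /eqP ->.
rewrite addrC Rintegral_itv_obnd_cbnd//.
apply: integrableS i => //; apply: subset_itv; by rewrite bnd_simp.
Qed.

Lemma H1per_increment L u du x y : H1per L u du -> 0 <= x -> x <= y -> y <= L ->
  u y - u x = \int[mu]_(t in `[x, y]) du t.
Proof.
move=> H x0 xy yL; have i := H1per_integrable H; case: H => _ _ h _.
have y0 := le_trans x0 xy; have xL := le_trans xy yL.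
rewrite (h y) ?in_itv/= ?y0// (h x) ?in_itv/= ?x0//.
rewrite (@Rintegral_itv_split 0 x y)//; first by ring.
exact: integrable_itvS i.
Qed.

Lemma H1per_continuous L u du : 0 <= L -> H1per L u du -> {within `[0, L], continuous u}.
Proof.
move=> L0 H; have i := H1per_integrable H; case: H => _ _ h _.
have := parameterized_integral_continuous L0 i.
move=> c.
apply: (@subspace_eq_continuous _ _ _ (fun x => u 0 + parameterized_integral mu 0 x du)).
  by move=> x; rewrite inE/= => xL; exact/esym/h.
move=> x; apply: cvgD; [exact: cvg_cst|exact: c].
Qed.

Lemma H1per_lin L u v du dv (a b : R) : H1per L u du -> H1per L v dv ->
  H1per L (fun x => a * u x + b * v x) (fun x => a * du x + b * dv x).
Proof.
move=> Hu Hv.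
have iu := H1per_integrable Hu; have iv := H1per_integrable Hv.
case: Hu => mu' u2 hu pu; case: Hv => mv v2 hv pv; split.
- by apply: measurable_funD; apply: measurable_funM.
- have mL : measurable `[0, L]%classic by [].
  have k := @integrable_mul_L2 _ _ _ mu _ mL _ _ mu' mv u2 v2.
  have := @integrable_add _ _ _ mu _ mL _ _
     (@integrable_add _ _ _ mu _ mL _ _
        (@integrable_scale _ _ _ mu _ mL _ (a ^+ 2) u2)
        (@integrable_scale _ _ _ mu _ mL _ (2 * a * b) k))
     (@integrable_scale _ _ _ mu _ mL _ (b ^+ 2) v2).
  by apply: eq_integrable => // x _; congr EFin => /=; ring.
- move=> x xL; rewrite hu// hv//.
  have [x0 xL'] : 0 <= x /\ x <= L by move: xL; rewrite in_itv/= => /andP.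
  have iu' := integrable_itvS (lexx 0) xL' iu; have iv' := integrable_itvS (lexx 0) xL' iv.
  rewrite RintegralD//; [|exact: integrable_scale..].
  rewrite !RintegralZl//; ring.
- by move=> x; rewrite pu pv.
Qed.

Lemma H1per_cst L (k : R) : H1per L (fun=> k) (fun=> 0).
Proof.
split=> //.
- have := @integrable0 _ _ R mu `[0, L]%classic.
  by apply: eq_integrable => // x _; rewrite expr0n.
- by move=> x _; rewrite Rintegral_cst// mul0r addr0.
Qed.

Lemma within_continuous_mul (A : set R) (f g : R -> R) : {within A, continuous f} ->
  {within A, continuous g} -> {within A, continuous (fun x => f x * g x)}.
Proof. by move=> cf cg x; apply: cvgM; [exact: cf|exact: cg]. Qed.

Lemma within_continuous_add (A : set R) (f g : R -> R) : {within A, continuous f} ->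
  {within A, continuous g} -> {within A, continuous (fun x => f x + g x)}.
Proof. by move=> cf cg x; apply: cvgD; [exact: cf|exact: cg]. Qed.

Lemma within_itv_integrable (a b : R) (f : R -> R) : {within `[a, b], continuous f} ->
  mu.-integrable `[a, b] (EFin \o f).
Proof. by apply: continuous_compact_integrable; exact: segment_compact. Qed.

Lemma H1per_integrable_fun L u du : 0 <= L -> H1per L u du -> mu.-integrable `[0, L] (EFin \o u).
Proof. by move=> L0 H; apply: within_itv_integrable; exact: H1per_continuous H. Qed.

Lemma H1per_integrable_sqr L u du : 0 <= L -> H1per L u du ->
  mu.-integrable `[0, L] (fun x => (u x ^+ 2)%:E).
Proof.
move=> L0 H; have c := H1per_continuous L0 H.
exact: (@within_itv_integrable 0 L (fun x => u x ^+ 2) (within_continuous_mul c c)).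
Qed.

End H1per.

Section sobolev.
Context (R : realType).
Notation mu := (@lebesgue_measure R).
Implicit Types (L : R) (u v du dv : R -> R).

Lemma Rintegral_itv_cst (a b k : R) : a <= b -> \int[mu]_(x in `[a, b]) k = k * (b - a).
Proof.
move=> ab; rewrite Rintegral_cst//= lebesgue_measure_itv/=.
by case: ifPn => //; rewrite lte_fin -leNgt => ba; rewrite (@le_anti _ _ a b) ?ab ?ba// subrr.
Qed.

Lemma ge0_Rintegral_itvS (a b c d : R) (f : R -> R) : a <= c -> d <= b ->
  mu.-integrable `[a, b] (EFin \o f) -> (forall x, 0 <= f x) ->
  \int[mu]_(x in `[c, d]) f x <= \int[mu]_(x in `[a, b]) f x.
Proof.
move=> ac db i f0; have i' := integrable_itvS ac db i.
rewrite /Rintegral fine_le//.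
- exact: integrable_fin_num i'.
- exact: integrable_fin_num i.
- apply: ge0_subset_integral => //.
  + exact: (measurable_int mu i).
  + by move=> x _; rewrite lee_fin.
  + exact: sub_itv_cc.
Qed.

Lemma H1per_increment_sqr L u du x y : H1per L u du -> 0 <= x -> x <= y -> y <= L ->
  (u y - u x) ^+ 2 <= (y - x) * \int[mu]_(t in `[0, L]) (du t ^+ 2).
Proof.
move=> H x0 xy yL; rewrite (H1per_increment H x0 xy yL).
have [m i _ _] := H.
have m' := measurable_itvS x0 yL m; have i' := integrable_itvS x0 yL i.
have i1 : mu.-integrable `[x, y] (fun x => (cst (1:R) x ^+ 2)%:E).
  by apply: (within_itv_integrable (f := cst (1 ^+ 2))) => z; exact: cvg_cst.
have := @cauchy_schwarz_Rintegral _ _ _ mu _ (measurable_itv `[x, y]) _ _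
  m' (measurable_cst (1:R)) i' i1.
under [X in X ^+ 2 <= _]eq_Rintegral do rewrite /= mulr1.
under [X in _ <= _ * X]eq_Rintegral do rewrite /= expr1n.
rewrite Rintegral_itv_cst// mul1r => /le_trans; apply.
rewrite mulrC ler_wpM2l ?subr_ge0//; apply: ge0_Rintegral_itvS i _ => // z.
exact: sqr_ge0.
Qed.

Lemma H1per_sobolev L u du x h : H1per L u du -> 0 <= x <= L -> 0 < h <= L ->
  u x ^+ 2 <= 2 / h * \int[mu]_(t in `[0, L]) (u t ^+ 2)
    + 2 * h * \int[mu]_(t in `[0, L]) (du t ^+ 2).
Proof.
move=> H /andP[x0 xL] /andP[h0 hL].
have L0 : 0 <= L by rewrite (le_trans x0).
set D := \int[mu]_(t in _) (du t ^+ 2).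
have D0 : 0 <= D by apply: Rintegral_ge0 => z _; exact: sqr_ge0.
have [p [p0 px xp pL]] : exists p, [/\ 0 <= p, p <= x, x <= p + h & p + h <= L].
  have [le|/ltW le] := leP (x + h) L; first by exists x; split => //; lra.
  by exists (L - h); split; lra.
have iu2 := H1per_integrable_sqr L0 H.
have pt y : `[p, p + h]%classic y -> u x ^+ 2 <= 2 * u y ^+ 2 + 2 * h * D.
  rewrite /= in_itv/= => /andP[py yp].
  have : (u x - u y) ^+ 2 <= h * D.
    have [xy|/ltW yx] := leP x y.
      have := H1per_increment_sqr H x0 xy (le_trans yp pL).
      rewrite -sqrrN opprB => /le_trans; apply.
      by apply: ler_wpM2r => //; lra.
    apply: (le_trans (H1per_increment_sqr H (le_trans p0 py) yx xL)).
    by apply: ler_wpM2r => //; lra.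
  have : 0 <= (u x - 2 * u y) ^+ 2 by exact: sqr_ge0.
  nra.
have ph : p <= p + h by rewrite lerDl ltW.
have ip2 := integrable_itvS p0 pL iu2.
have ic (k : R) : mu.-integrable `[p, p + h] (EFin \o (fun=> k)).
  by apply: (within_itv_integrable (f := cst k)) => z; exact: cvg_cst.
have mp : measurable `[p, p + h]%classic by [].
have i2 := @integrable_scale _ _ _ mu _ mp _ 2 ip2.
have := @le_Rintegral _ _ _ mu `[p, p + h]%classic (fun=> u x ^+ 2)
  (fun y => 2 * u y ^+ 2 + 2 * h * D) mp (ic _)
  (@integrable_add _ _ _ mu _ mp _ _ i2 (ic _)) pt.
rewrite RintegralD// RintegralZl// !Rintegral_itv_cst//.
have -> : p + h - p = h by ring.
have := @ge0_Rintegral_itvS 0 L p (p + h) (fun t => u t ^+ 2) p0 pL iu2 (fun z => sqr_ge0 _).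
set B := \int[mu]_(t in `[0, L]) _; set B' := \int[mu]_(t in _) _ => BB le1.
have -> : 2 / h * B + 2 * h * D = (2 * B + 2 * h * D * h) / h.
  by field; rewrite gt_eqF.
rewrite ler_pdivlMr//; apply: le_trans le1 _; lra.
Qed.

(* Take [h = ||u|| / ||u'||] in [H1per_sobolev], capped at the period. *)
Lemma H1per_agmon L u du x : 0 < L -> H1per L u du -> 0 <= x <= L ->
  u x ^+ 2 <= Num.sqrt (\int[mu]_(t in `[0, L]) (u t ^+ 2)) *
    (4 * Num.sqrt (\int[mu]_(t in `[0, L]) (du t ^+ 2))
     + 2 / L * Num.sqrt (\int[mu]_(t in `[0, L]) (u t ^+ 2))).
Proof.
move=> L0 H xL.
have := H1per_sobolev H xL.
set B := \int[mu]_(t in _) (u t ^+ 2); set D := \int[mu]_(t in _) (du t ^+ 2).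
have D0 : 0 <= D by apply: Rintegral_ge0 => z _; exact: sqr_ge0.
have B0 : 0 <= B by apply: Rintegral_ge0 => z _; exact: sqr_ge0.
rewrite -{1}(sqr_sqrtr D0) -{1}(sqr_sqrtr B0).
move: (sqrtr_ge0 D) (sqrtr_ge0 B) => {B0 D0}.
move: (Num.sqrt D) (Num.sqrt B) => s b s0 b0 h.
have [le|lt] := leP (L * s) b.
  apply: (le_trans (h L _)); first by rewrite L0 lexx.
  have -> : 2 / L * b ^+ 2 = b * (2 / L * b) by ring.
  rewrite mulrDr addrC lerD2r.
  have : s * (L * s) <= s * b by rewrite ler_wpM2l.
  nra.
have sp : 0 < s by nra.
have Lb : 0 <= b * (2 / L * b) by rewrite !mulr_ge0// invr_ge0 ltW.
rewrite mulrDr; move: b0; rewrite le_eqVlt => /predU1P[b0|b0].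
  rewrite -b0 in h *; rewrite !mul0r addr0 leNgt; apply/negP => u0.
  pose k := Num.min L (u x ^+ 2 / (4 * s ^+ 2)).
  have k0 : 0 < k by rewrite lt_min L0/= divr_gt0// mulr_gt0// exprn_gt0.
  have := h k; rewrite k0 ge_min lexx/= => /(_ isT).
  rewrite expr0n/= mulr0 add0r.
  have : k * (4 * s ^+ 2) <= u x ^+ 2.
    by rewrite -ler_pdivlMr ?mulr_gt0 ?exprn_gt0// ge_min lexx orbT.
  by nra.
have := h (b / s); rewrite divr_gt0//= ler_pdivrMr// ltW// => /(_ isT).
have -> : 2 / (b / s) * b ^+ 2 + 2 * (b / s) * s ^+ 2 = b * (4 * s).
  by field; rewrite !gt_eqF.
lra.
Qed.

Lemma supnorm_has_ubound L u du : 0 < L -> H1per L u du ->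
  has_ubound [set `|u x| | x in `[0, L]].
Proof.
move=> L0 H; eexists => _ [x xL <-].
rewrite -sqrtr_sqr; apply: ler_wsqrtr; exact: H1per_agmon H _.
Qed.

Lemma sqr_le_supnorm L u du x : 0 < L -> H1per L u du -> 0 <= x <= L ->
  u x ^+ 2 <= supnorm L u ^+ 2.
Proof.
move=> L0 H xL.
have le : `|u x| <= supnorm L u.
  by apply: (ub_le_sup (supnorm_has_ubound L0 H)); exists x => //=; rewrite in_itv.
by rewrite -real_normK ?num_real// ler_sqr ?nnegrE// (le_trans _ le).
Qed.

Lemma supnorm_sqr_le L u (C : R) : 0 <= L -> (forall x, 0 <= x <= L -> u x ^+ 2 <= C) ->
  supnorm L u ^+ 2 <= C.
Proof.
move=> L0 h.
have C0 : 0 <= C by rewrite (le_trans (sqr_ge0 (u 0)))// h// lexx.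
rewrite -(sqr_sqrtr C0) ler_sqr ?nnegrE ?sqrtr_ge0//.
- apply: ge_sup; first by exists `|u 0|, 0 => //=; rewrite in_itv/= lexx.
  move=> _ [x xL <-]; rewrite -sqrtr_sqr; apply/ler_wsqrtr/h.
  by move: xL; rewrite /= in_itv.
- apply: le_trans (_ : `|u 0| <= _) => //; apply: ub_le_sup.
    exists (Num.sqrt C) => _ [x xL <-]; rewrite -sqrtr_sqr; apply/ler_wsqrtr/h.
    by move: xL; rewrite /= in_itv.
  by exists 0 => //=; rewrite in_itv/= lexx.
Qed.

End sobolev.

(** * A Schur test *)

Section schur.
Context d (X : measurableType d) (R : realType).
Context (mu : {sigma_finite_measure set X -> \bar R}).

Lemma measurable_sqr_div (S : set X) (f w : X -> R) :
  measurable_fun S f -> measurable_fun S w -> (forall t, S t -> 0 < w t) ->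
  measurable_fun S (fun t => f t ^+ 2 / w t).
Proof.
move=> mf mw w0; apply: measurable_funM; first exact: measurable_funX.
apply: (@measurable_comp _ _ _ _ _ _ [set x : R | x != 0] (fun x => x^-1) S w) => //.
- by apply: open_measurable; exact: open_neq.
- by move=> _ [t St <-]; rewrite /= gt_eqF// w0.
- apply: open_continuous_measurable_fun; first exact: open_neq.
  by move=> x; rewrite inE/= => x0; exact: inv_continuous.
Qed.

(* Weighted AM-GM: [2 y |f| <= s f^2 / w + y^2 w / s] with [y = |v|]. *)
Lemma schur_pointwise (S : set X) (f w : X -> R) (v s : R) :
  measurable S -> measurable_fun S f -> measurable_fun S w ->
  (forall t, S t -> 0 < w t) -> 0 < s ->
  (`|v|%:E <= \int[mu]_(t in S) `|f t|%:E)%E ->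
  (\int[mu]_(t in S) (w t)%:E <= s%:E)%E ->
  ((v ^+ 2)%:E <= s%:E * \int[mu]_(t in S) (f t ^+ 2 / w t)%:E)%E.
Proof.
move=> mS mf mw w0 s0 hv hw.
have mfw := measurable_sqr_div mf mw w0.
have w0' t : S t -> (0 <= (w t)%:E)%E by move=> /w0/ltW; rewrite lee_fin.
have g0 t : S t -> (0 <= (f t ^+ 2 / w t)%:E)%E.
  by move=> St; rewrite lee_fin divr_ge0 ?sqr_ge0// ltW// w0.
have main : ((2 * `|v|)%:E * \int[mu]_(t in S) `|f t|%:E <=
    s%:E * \int[mu]_(t in S) (f t ^+ 2 / w t)%:E +
    (v ^+ 2 / s)%:E * \int[mu]_(t in S) (w t)%:E)%E.
  have k1 : (0 <= (2 * `|v|)%:E)%E by rewrite lee_fin mulr_ge0.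
  have k2 : (0 <= s%:E)%E by rewrite lee_fin ltW.
  have k3 : (0 <= (v ^+ 2 / s)%:E)%E by rewrite lee_fin divr_ge0 ?sqr_ge0// ltW.
  have m1 : measurable_fun S (fun t => `|f t|%:E).
    by apply/measurable_EFinP; exact: measurableT_comp.
  have m2 : measurable_fun S (fun t => (f t ^+ 2 / w t)%:E) by exact/measurable_EFinP.
  have m3 : measurable_fun S (fun t => (w t)%:E) by exact/measurable_EFinP.
  rewrite -(@ge0_integralZl _ _ _ mu _ mS _ m1 _ (fun _ _ => normr_ge0 _) k1).
  rewrite -(@ge0_integralZl _ _ _ mu _ mS _ m2 _ g0 k2).
  rewrite -(@ge0_integralZl _ _ _ mu _ mS _ m3 _ w0' k3).
  rewrite -ge0_integralD//; last 4 first.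
  - by move=> t St; rewrite mule_ge0 ?g0// lee_fin ltW.
  - by apply: measurable_funeM; apply/measurable_EFinP.
  - by move=> t St; rewrite mule_ge0 ?w0'// lee_fin divr_ge0 ?sqr_ge0// ltW.
  - by apply: measurable_funeM; apply/measurable_EFinP.
  apply: ge0_le_integral => //.
  - by apply: measurable_funeM; apply/measurable_EFinP; exact: measurableT_comp.
  - by apply: emeasurable_funD; apply: measurable_funeM; apply/measurable_EFinP.
  - move=> t St; rewrite lee_fin -subr_ge0.
    have wt := w0 t St.
    have -> : s * (f t ^+ 2 / w t) + v ^+ 2 / s * w t - 2 * `|v| * `|f t| =
       (s * `|f t| - `|v| * w t) ^+ 2 / (s * w t).
      rewrite -(real_normK (num_real (f t))) -(real_normK (num_real v)).
      by field; rewrite !gt_eqF.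
    by rewrite divr_ge0 ?sqr_ge0// mulr_ge0// ltW.
have le1 : ((2 * `|v|)%:E * `|v|%:E <= (2 * `|v|)%:E * \int[mu]_(t in S) `|f t|%:E)%E.
  by rewrite lee_wpmul2l// lee_fin mulr_ge0.
have le2 : ((v ^+ 2 / s)%:E * \int[mu]_(t in S) (w t)%:E <= (v ^+ 2)%:E)%E.
  have : ((v ^+ 2 / s)%:E * \int[mu]_(t in S) (w t)%:E <= (v ^+ 2 / s)%:E * s%:E)%E.
    by rewrite lee_wpmul2l// lee_fin divr_ge0 ?sqr_ge0// ltW.
  by rewrite -EFinM divfK// gt_eqF.
have := le_trans le1 (le_trans main (leeD2l _ le2)).
rewrite -leeBlDr// -EFinM -EFinB; congr (_ <= _)%E; congr EFin.
by rewrite -(real_normK (num_real v)); ring.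
Qed.

Lemma schur_test (D : set X) (T : set (X * X)) (f s w v : X -> R) :
  measurable D -> measurable T -> T `<=` D `*` D ->
  measurable_fun D f -> measurable_fun D v ->
  measurable_fun D s -> measurable_fun D w ->
  (forall x, D x -> 0 < s x) -> (forall x, D x -> 0 < w x) ->
  (forall x, D x -> (`|v x|%:E <= \int[mu]_(t in xsection T x) `|f t|%:E)%E) ->
  (forall x, D x -> (\int[mu]_(t in xsection T x) (w t)%:E <= (s x)%:E)%E) ->
  (forall t, D t -> (\int[mu]_(x in ysection T t) (s x)%:E <= (w t)%:E)%E) ->
  (\int[mu]_(x in D) (v x ^+ 2)%:E <= \int[mu]_(x in D) (f x ^+ 2)%:E)%E.
Proof.
move=> mD mT TD mf mv ms mw s0 w0 hv hw hs.
pose g := (fun t => f t ^+ 2 / w t) \_ D.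
pose s' := s \_ D.
have mg : measurable_fun setT g.
  apply/(measurable_restrictT _ mD).1.
  exact: measurable_sqr_div.
have ms' : measurable_fun setT s' by apply/(measurable_restrictT _ mD).1.
have g0 t : 0 <= g t.
  by rewrite /g patchE; case: ifPn => // /set_mem Dt; rewrite divr_ge0 ?sqr_ge0// ltW ?w0.
have s'0 t : 0 <= s' t by rewrite /s' patchE; case: ifPn => // /set_mem Dt; rewrite ltW ?s0.
pose F z := (s' z.1 * g z.2 * \1_T z)%:E.
have mF : measurable_fun setT F.
  apply/measurable_EFinP; apply: measurable_funM; last exact: measurable_indic.
  by apply: measurable_funM; exact: measurableT_comp.
have F0 z : (0 <= F z)%E by rewrite lee_fin !mulr_ge0.
have Fx x : (\int[mu]_t F (x, t) = (s' x)%:E * \int[mu]_(t in xsection T x) (g t)%:E)%E.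
  rewrite -ge0_integralZl ?lee_fin//.
  - rewrite [RHS]integral_mkcond; apply: eq_integral => t _.
    rewrite /F/= patchE indicE mem_xsection.
    by case: ifP => _ /=; rewrite ?mulr1 ?mulr0.
  - exact: measurable_xsection.
  - by apply/measurable_EFinP; exact: measurable_funTS.
  - by move=> ? _; rewrite lee_fin.
have Fy t : (\int[mu]_x F (x, t) = (g t)%:E * \int[mu]_(x in ysection T t) (s' x)%:E)%E.
  rewrite -ge0_integralZl ?lee_fin//.
  - rewrite [RHS]integral_mkcond; apply: eq_integral => x _.
    rewrite /F/= patchE indicE mem_ysection.
    by case: ifP => _ /=; rewrite ?mulr1 ?mulr0// mulrC.
  - exact: measurable_ysection.
  - by apply/measurable_EFinP; exact: measurable_funTS.
  - by move=> ? _; rewrite lee_fin.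
have xD x t : xsection T x t -> D x /\ D t.
  by rewrite /xsection/= => /set_mem /TD.
have yD t x : ysection T t x -> D x /\ D t.
  by rewrite /ysection/= => /set_mem /TD.
have fub := @fubini_tonelli _ _ _ _ _ mu mu F mF F0.
apply: (@le_trans _ _ (\int[mu]_x \int[mu]_t F (x, t))%E).
  rewrite integral_mkcond; apply: ge0_le_integral; first exact: measurableT.
  - by move=> x _; rewrite erestrict_ge0// => ? _; rewrite lee_fin sqr_ge0.
  - apply/(measurable_restrictT _ mD).1.
    by apply/measurable_EFinP; exact: measurable_funX.
  - exact: measurable_fun_fubini_tonelli_F.
  move=> x _; rewrite Fx patchE; case: ifPn => [/set_mem Dx|_]; last first.
    by apply: mule_ge0; [|apply: integral_ge0 => t _]; rewrite lee_fin.
  have -> : s' x = s x by rewrite /s' patchE mem_set.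
  have -> : (\int[mu]_(t in xsection T x) (g t)%:E =
      \int[mu]_(t in xsection T x) (f t ^+ 2 / w t)%:E)%E.
    by apply: eq_integral => t /set_mem /xD[_ Dt]; rewrite /g patchE mem_set.
  have sub : xsection T x `<=` D by move=> t /xD[].
  apply: schur_pointwise; [exact: measurable_xsection|exact: measurable_funS mf
    |exact: measurable_funS mw| |exact: s0|exact: hv|exact: hw].
  by move=> t /xD[_ /w0].
rewrite fub [leRHS]integral_mkcond; apply: ge0_le_integral; first exact: measurableT.
- by move=> x _; apply: integral_ge0.
- exact: measurable_fun_fubini_tonelli_G.
- apply/(measurable_restrictT _ mD).1.
  by apply/measurable_EFinP; exact: measurable_funX.
move=> t _; rewrite Fy /g !patchE; case: ifPn => [/set_mem Dt|_]; last first.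
  by rewrite -[point]/(0 : R) mul0e.
have -> : (\int[mu]_(x in ysection T t) (s' x)%:E = \int[mu]_(x in ysection T t) (s x)%:E)%E.
  by apply: eq_integral => x /set_mem /yD[Dx _]; rewrite /s' patchE mem_set.
have wt := w0 _ Dt.
have : ((f t ^+ 2 / w t)%:E * \int[mu]_(x in ysection T t) (s x)%:E <=
    (f t ^+ 2 / w t)%:E * (w t)%:E)%E.
  by rewrite lee_wpmul2l ?hs// lee_fin divr_ge0 ?sqr_ge0// ltW.
by rewrite -EFinM divfK// gt_eqF.
Qed.

End schur.

Section quarter.
Context (R : realType).
Notation mu := (@lebesgue_measure R).

Lemma integral_cos_shift (a x y : R) : x <= y ->
  (\int[mu]_(t in `[x, y]) (cos (t - a))%:E = (sin (y - a) - sin (x - a))%:E)%E.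
Proof.
rewrite le_eqVlt => /predU1P[->|xy]; first by rewrite set_itv1 integral_set1 subrr.
have dF (t : R) : is_derive t (1 : R) (fun t => sin (t - a)) (cos (t - a)).
  have := @is_derive1_comp _ sin (fun t => t - a) t _ _ (is_derive_sin (t - a))
    (is_deriveB (is_derive_id t 1) (is_derive_cst a t 1)).
  by rewrite subr0 mulr1.
have cc : continuous (fun t : R => cos (t - a)).
  move=> t; apply: (@continuous_comp _ _ _ (fun t => t - a) cos); last exact: continuous_cos.
  by apply: cvgB; [exact: cvg_id|exact: cvg_cst].
have cs : continuous (fun t : R => sin (t - a)).
  by move=> t; apply: differentiable_continuous; apply/derivable1_diffP; case: (dF t).
rewrite (@continuous_FTC2 _ (fun t => cos (t - a)) (fun t => sin (t - a)))//.
- exact: continuous_subspaceT.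
- split.
  + by move=> t _; case: (dF t).
  + exact: cvg_at_right_filter (cs _).
  + exact: cvg_at_left_filter (cs _).
- by move=> t _; rewrite derive1E; apply: derive_val.
Qed.

Lemma integral_sin_shift (a x y : R) : x <= y ->
  (\int[mu]_(t in `[x, y]) (sin (t - a))%:E = (cos (x - a) - cos (y - a))%:E)%E.
Proof.
move=> xy; have := integral_cos_shift (a + pi / 2) xy.
under eq_integral do rewrite opprD addrA cosBpihalf.
move=> ->; congr EFin; rewrite !opprD !addrA !sinBpihalf; ring.
Qed.

Lemma measurable_sin_shift (a : R) (D : set R) : measurable_fun D (fun t => sin (t - a)).
Proof.
apply: measurable_funTS; apply: continuous_measurable_fun => t.
apply: (@continuous_comp _ _ _ (fun t => t - a) sin); last exact: continuous_sin.
by apply: cvgB; [exact: cvg_id|exact: cvg_cst].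
Qed.

Lemma measurable_cos_shift (a : R) (D : set R) : measurable_fun D (fun t => cos (t - a)).
Proof.
apply: measurable_funTS; apply: continuous_measurable_fun => t.
apply: (@continuous_comp _ _ _ (fun t => t - a) cos); last exact: continuous_cos.
by apply: cvgB; [exact: cvg_id|exact: cvg_cst].
Qed.

Lemma measurable_triangle (a b : R) :
  measurable [set z : measurableTypeR R * measurableTypeR R | [/\ a < z.2, z.2 <= z.1 & z.1 < b]].
Proof.
rewrite (_ : [set _ | _] = [set z | a < z.2] `&` [set z | 0 <= z.1 - z.2] `&` [set z | z.1 < b]).
  apply: measurableI; first apply: measurableI.
  - have := @measurable_snd _ _ (measurableTypeR R) (measurableTypeR R) measurableT
      `]a, +oo[%classic (measurable_itv _).
    by rewrite setTI; congr measurable; apply/seteqP; split => z; rewrite /= in_itv/= andbT.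
  - have := @measurable_funB _ _ _ setT _ _
      (@measurable_fst _ _ (measurableTypeR R) (measurableTypeR R))
      (@measurable_snd _ _ (measurableTypeR R) (measurableTypeR R)) measurableT
      `[0, +oo[%classic (measurable_itv _).
    by rewrite setTI; congr measurable; apply/seteqP; split => z; rewrite /= in_itv/= andbT.
  - have := @measurable_fst _ _ (measurableTypeR R) (measurableTypeR R) measurableT
      `]-oo, b[%classic (measurable_itv _).
    by rewrite setTI; congr measurable; apply/seteqP; split => z; rewrite /= in_itv/=.
by apply/seteqP; split => z /=; rewrite subr_ge0; [case|case; case].
Qed.

Lemma xsection_triangle (a b x : R) : x < b ->
  xsection [set z : measurableTypeR R * measurableTypeR R | [/\ a < z.2, z.2 <= z.1 & z.1 < b]] x
  = `]a, x]%classic.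
Proof.
move=> xb; apply/seteqP; split => t; rewrite /xsection/= inE/= in_itv/=.
  by case=> -> ->.
by move=> /andP[].
Qed.

Lemma ysection_triangle (a b t : R) : a < t ->
  ysection [set z : measurableTypeR R * measurableTypeR R | [/\ a < z.2, z.2 <= z.1 & z.1 < b]] t
  = `[t, b[%classic.
Proof.
move=> xb; apply/seteqP; split => x; rewrite /ysection/= inE/= in_itv/=.
  by case=> _ -> ->.
by move=> /andP[].
Qed.

Lemma quarter_left (a : R) (f v : R -> R) :
  measurable_fun `]a, a + pi / 2[ f -> measurable_fun `]a, a + pi / 2[ v ->
  (forall x, a < x < a + pi / 2 -> (`|v x|%:E <= \int[mu]_(t in `[a, x]) `|f t|%:E)%E) ->
  (\int[mu]_(x in `]a, (a + pi / 2)%R[) (v x ^+ 2)%:E <=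
   \int[mu]_(x in `]a, (a + pi / 2)%R[) (f x ^+ 2)%:E)%E.
Proof.
set b := a + pi / 2 => mf mv hv.
have ba : b - a = pi / 2 by rewrite /b addrC addKr.
have Dab x : `]a, b[%classic x -> a < x < b by rewrite /= in_itv.
apply: (@schur_test _ _ _ mu _ _ f (fun x => sin (x - a)) (fun t => cos (t - a)) v
  (measurable_itv _) (measurable_triangle a b)) => //.
- move=> z [/= az zz zb]; split; rewrite /= in_itv/=; apply/andP; split => //.
    exact: lt_le_trans zz.
  exact: le_lt_trans zb.
- exact: measurable_sin_shift.
- exact: measurable_cos_shift.
- by move=> x /Dab/andP[ax xb]; rewrite sin_gt0_pihalf// subr_gt0 ax ltrBlDl.
- move=> x /Dab/andP[ax xb]; rewrite cos_gt0_pihalf// ltrBlDl xb andbT.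
  by rewrite (lt_trans _ (_ : 0 < x - a)) ?subr_gt0// oppr_lt0 divr_gt0// pi_gt0.
- move=> x /[dup] /Dab/andP[ax xb] _; rewrite xsection_triangle//.
  rewrite (le_trans (hv x _)) ?ax// -integral_itv_obnd_cbnd//.
  apply: measurable_funS (measurable_itv `]a, b[) _ _.
    by apply: subset_itv; rewrite bnd_simp.
  by apply/measurable_EFinP; exact: measurableT_comp.
- move=> x /Dab/andP[ax xb]; rewrite xsection_triangle//.
  rewrite integral_itv_obnd_cbnd; last by apply/measurable_EFinP; exact: measurable_cos_shift.
  by rewrite integral_cos_shift ?(ltW ax)// subrr sin0 subr0.
- move=> t /Dab/andP[at_ tb]; rewrite ysection_triangle//.
  rewrite integral_itv_bndo_bndc; last by apply/measurable_EFinP; exact: measurable_sin_shift.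
  by rewrite integral_sin_shift ?(ltW tb)// ba cos_pihalf subr0.
Qed.

Lemma quarter_right (a : R) (f v : R -> R) :
  measurable_fun `]a, a + pi / 2[ f -> measurable_fun `]a, a + pi / 2[ v ->
  (forall x, a < x < a + pi / 2 ->
    (`|v x|%:E <= \int[mu]_(t in `[x, (a + pi / 2)%R]) `|f t|%:E)%E) ->
  (\int[mu]_(x in `]a, (a + pi / 2)%R[) (v x ^+ 2)%:E <=
   \int[mu]_(x in `]a, (a + pi / 2)%R[) (f x ^+ 2)%:E)%E.
Proof.
set b := a + pi / 2 => mf mv hv.
have ba : b - a = pi / 2 by rewrite /b addrC addKr.
have Dab x : `]a, b[%classic x -> a < x < b by rewrite /= in_itv.
pose T := [set z : measurableTypeR R * measurableTypeR R | [/\ a < z.2, z.2 <= z.1 & z.1 < b]].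
pose T' := @unstable.swap (measurableTypeR R) (measurableTypeR R) @^-1` T.
have xT x : xsection T' x = ysection T x.
  by apply/seteqP; split => t; rewrite /xsection /ysection/= !inE.
have yT x : ysection T' x = xsection T x.
  by apply/seteqP; split => t; rewrite /xsection /ysection/= !inE.
apply: (@schur_test _ _ _ mu _ T' f
  (fun x => cos (x - a)) (fun t => sin (t - a)) v (measurable_itv _)) => //.
- rewrite -[X in measurable X]setTI.
  apply: (@measurable_swap _ _ (measurableTypeR R) (measurableTypeR R)) => //.
  exact: measurable_triangle.
- move=> z [/= az zz zb]; split; rewrite /= in_itv/=; apply/andP; split => //.
    exact: le_lt_trans zb.
  exact: lt_le_trans zz.
- exact: measurable_cos_shift.
- exact: measurable_sin_shift.
- move=> x /Dab/andP[ax xb]; rewrite cos_gt0_pihalf// ltrBlDl xb andbT.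
  by rewrite (lt_trans _ (_ : 0 < x - a)) ?subr_gt0// oppr_lt0 divr_gt0// pi_gt0.
- by move=> x /Dab/andP[ax xb]; rewrite sin_gt0_pihalf// subr_gt0 ax ltrBlDl.
- move=> x /[dup] /Dab/andP[ax xb] _; rewrite xT ysection_triangle//.
  rewrite (le_trans (hv x _)) ?ax// -integral_itv_bndo_bndc//.
  apply: measurable_funS (measurable_itv `]a, b[) _ _.
    by apply: subset_itv; rewrite bnd_simp.
  by apply/measurable_EFinP; exact: measurableT_comp.
- move=> x /Dab/andP[ax xb]; rewrite xT ysection_triangle//.
  rewrite integral_itv_bndo_bndc; last by apply/measurable_EFinP; exact: measurable_sin_shift.
  by rewrite integral_sin_shift ?(ltW xb)// ba cos_pihalf subr0.
- move=> t /Dab/andP[at_ tb]; rewrite yT xsection_triangle//.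
  rewrite integral_itv_obnd_cbnd; last by apply/measurable_EFinP; exact: measurable_cos_shift.
  by rewrite integral_cos_shift ?(ltW at_)// subrr sin0 subr0.
Qed.

End quarter.

(** * Translation invariance and periodic integrands *)

Section shift.
Context (R : realType).
Notation mu := (@lebesgue_measure R).

Lemma measurable_addr (c : R) :
  measurable_fun setT (fun x : measurableTypeR R => (x + c : measurableTypeR R)).
Proof. by apply: measurable_funD => //; exact: measurable_cst. Qed.

Lemma lebesgue_measure_addr (c : R) (A : set R) : measurable A ->
  pushforward mu (fun x : measurableTypeR R => (x + c : measurableTypeR R)) A = mu A.
Proof.
pose mmix := isMeasurableFun.Build _ _ _ _ _ (measurable_addr c).
pose mphi : {mfun measurableTypeR R >-> measurableTypeR R} :=
  MeasurableFun.Pack (MeasurableFun.Class mmix).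
move=> mA; apply/esym.
apply: (@lebesgue_measure_unique R (pushforward mu mphi)) => //= _ [[a b]] _ <-.
rewrite /pushforward (_ : _ @^-1` _ = `]a - c, b - c]%classic).
  rewrite !lebesgue_measure_itv/= !lte_fin ltrD2r; case: ifP => // _.
  by rewrite -!EFinB opprB addrA subrK.
by apply/seteqP; split => x; rewrite /= !in_itv/= ltrBlDr lerBrDr.
Qed.

Lemma ge0_integral_addr (c : R) (D : set R) (f : R -> \bar R) :
  measurable D -> measurable_fun D f -> (forall x, D x -> (0 <= f x)%E) ->
  (\int[mu]_(x in D) f x = \int[mu]_(x in (fun x => x + c)%R @^-1` D) f (x + c)%R)%E.
Proof.
move=> mD mf f0.
have := @ge0_integral_pushforward _ _ (measurableTypeR R) (measurableTypeR R) R _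
  (measurable_addr c) mu D f mD mf.
move=> <-; last by move=> x /set_mem; exact: f0.
apply: eq_measure_integral => [|m A mA _]; first exact: measurable_addr.
exact/esym/lebesgue_measure_addr.
Qed.

Lemma preimage_addr_itv (c a b : R) (l r : bool) :
  (fun x => x + c) @^-1` [set` Interval (BSide l (a + c)) (BSide r (b + c))]
  = [set` Interval (BSide l a) (BSide r b)].
Proof.
by apply/seteqP; split => x; case: l; case: r; rewrite /= !in_itv/= ?lerD2r ?ltrD2r.
Qed.

Lemma measurable_fun_addr (c : R) (D : set R) (f : R -> R) : measurable D ->
  measurable_fun D f -> measurable_fun ((fun x => x + c) @^-1` D) (fun x => f (x + c)).
Proof.
move=> mD mf; apply: (measurable_comp mD _ mf); first by move=> _ [x Dx <-].
by apply: measurable_funTS; exact: measurable_addr.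
Qed.

Lemma integrable_addr (c : R) (D : set R) (f : R -> R) : measurable D ->
  mu.-integrable D (EFin \o f) ->
  mu.-integrable ((fun x => x + c) @^-1` D) (EFin \o (fun x => f (x + c))).
Proof.
move=> mD /integrableP[/measurable_EFinP mf foo]; apply/integrableP; split.
  by apply/measurable_EFinP; exact: measurable_fun_addr.
apply: le_lt_trans foo; rewrite [leRHS](@ge0_integral_addr c)//.
by apply: measurableT_comp => //; apply/measurable_EFinP.
Qed.

Lemma Rintegral_addr (c : R) (D : set R) (f : R -> R) : measurable D ->
  measurable_fun D f ->
  \int[mu]_(x in D) f x = \int[mu]_(x in (fun x => x + c) @^-1` D) f (x + c).
Proof.
move=> mD /measurable_EFinP mf; congr fine.
rewrite integralE [RHS]integralE; congr (_ - _)%E.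
- rewrite [LHS](@ge0_integral_addr c)//; last exact: measurable_funepos.
  by apply: eq_integral => x _; rewrite !funeposE.
- rewrite [LHS](@ge0_integral_addr c)//; last exact: measurable_funeneg.
  by apply: eq_integral => x _; rewrite !funenegE.
Qed.

Lemma eq_itv_preimage_subr (L a b : R) (l r : bool) :
  (fun x => x - L) @^-1` [set` Interval (BSide l a) (BSide r b)]
  = [set` Interval (BSide l (a + L)) (BSide r (b + L))].
Proof.
by have := @preimage_addr_itv (- L) (a + L) (b + L) l r; rewrite !addrK.
Qed.

Lemma integrable_disjU d (T : measurableType d) (nu : {measure set T -> \bar R})
    (A B : set T) (f : T -> \bar R) :
  measurable A -> measurable B -> [disjoint A & B] ->
  nu.-integrable A f -> nu.-integrable B f -> nu.-integrable (A `|` B) f.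
Proof.
move=> mA mB AB /integrableP[mfA fA] /integrableP[mfB fB].
have mfAB : measurable_fun (A `|` B) f by apply/measurable_funU.
apply/integrableP; split => //; rewrite ge0_integral_setU//; first by rewrite lte_add_pinfty.
exact: measurableT_comp.
Qed.

Section extension.
Context (L : R) (f : R -> R) (L0 : 0 <= L).
Context (fL : forall x, 0 < x <= L -> f (x + L) = f x).

Lemma measurable_periodic : measurable_fun `[0, L] f -> measurable_fun `[0, L + L] f.
Proof.
move=> mf; have -> : `[0, L + L]%classic = `[0, L]%classic `|` `]L, L + L]%classic.
  by rewrite -itv_bndbnd_setU ?bnd_simp// lerDl.
apply/measurable_funU => //; split => //.
have := @measurable_fun_addr (- L) `]0, L]%classic f (measurable_itv _).
rewrite eq_itv_preimage_subr add0r => h.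
have : measurable_fun `]L, L + L] (fun x => f (x - L)).
  by apply: h; apply: measurable_funS mf => //; apply: subset_itv; rewrite bnd_simp.
apply: eq_measurable_fun => x /set_mem; rewrite /= in_itv/= => /andP[Lx xL].
by rewrite -[in RHS](subrK L x) fL// subr_gt0 Lx/= lerBlDr.
Qed.

Lemma integrable_periodic : mu.-integrable `[0, L] (EFin \o f) ->
  mu.-integrable `[0, L + L] (EFin \o f).
Proof.
move=> i; have mf : measurable_fun `[0, L] f by apply/measurable_EFinP; exact: measurable_int i.
have -> : `[0, L + L]%classic = `[0, L]%classic `|` `]L, L + L]%classic.
  by rewrite -itv_bndbnd_setU ?bnd_simp// lerDl.
apply: integrable_disjU => //.
  apply/disj_setPS => y [/=]; rewrite 2!in_itv/= => /andP[_ yL] /andP[].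
  by rewrite ltNge yL.
have := @integrable_addr (- L) `]0, L]%classic f (measurable_itv _).
rewrite eq_itv_preimage_subr add0r => h.
have : mu.-integrable `]L, L + L] (EFin \o (fun x => f (x - L))).
  by apply: h; apply: integrableS i => //; apply: subset_itv; rewrite bnd_simp.
apply: eq_integrable => // x /set_mem; rewrite /= in_itv/= => /andP[Lx xL].
by rewrite -[in RHS](subrK L x) fL// subr_gt0 Lx/= lerBlDr.
Qed.

Lemma Rintegral_periodic_tail (c : R) : 0 <= c <= L -> mu.-integrable `[0, L] (EFin \o f) ->
  \int[mu]_(x in `[L, c + L]) f x = \int[mu]_(x in `[0, c]) f x.
Proof.
move=> /andP[c0 cL] i; have i2 := integrable_periodic i.
rewrite -!Rintegral_itv_obnd_cbnd; last 2 first.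
- by apply: integrableS i => //; apply: subset_itv; rewrite bnd_simp.
- by apply: integrableS i2 => //; apply: subset_itv; rewrite bnd_simp// lerD2r.
rewrite (@Rintegral_addr L); [|by []|]; last first.
  apply: measurable_funS (_ : measurable_fun `[0, L + L] f) => //.
    by apply: subset_itv; rewrite bnd_simp// lerD2r.
  by apply/measurable_EFinP; exact: measurable_int i2.
have := @preimage_addr_itv L 0 c false false; rewrite add0r => ->.
apply: eq_Rintegral => x /set_mem; rewrite /= in_itv/= => /andP[x0 xc].
by rewrite fL// x0 (le_trans xc).
Qed.

Lemma Rintegral_periodic (c : R) : 0 <= c <= L -> mu.-integrable `[0, L] (EFin \o f) ->
  \int[mu]_(x in `[c, c + L]) f x = \int[mu]_(x in `[0, L]) f x.
Proof.
move=> /andP[c0 cL] i; have i2 := integrable_periodic i.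
rewrite (@Rintegral_itv_split _ c L)//; last 2 first.
- by rewrite lerDr.
- by apply: integrable_itvS i2 => //; rewrite lerD2r.
rewrite Rintegral_periodic_tail ?c0// (@Rintegral_itv_split _ 0 c L)//.
by rewrite addrC.
Qed.

End extension.

End shift.

(** * The sharp Wirtinger inequality *)

Section wirtinger.
Context (R : realType).
Notation mu := (@lebesgue_measure R).
Implicit Types (L : R) (u v du dv : R -> R).

Lemma within_continuous_addr (a b c : R) u : {within `[a + c, b + c], continuous u} ->
  {within `[a, b], continuous (fun x => u (x + c))}.
Proof.
move=> /subspace_continuousP h; apply/subspace_continuousP => x.
rewrite /= in_itv/= => /andP[ax xb].
have xc : `[a + c, b + c]%classic (x + c) by rewrite /= in_itv/= !lerD2r ax.
apply: (@cvg_comp _ _ _ (fun z => z + c) u _ _ _ _ (h _ xc)) => P BP.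
have cont : (fun z : R => z + c) @ x --> x + c by apply: cvgD; [exact: cvg_id|exact: cvg_cst].
have N : nbhs x (fun z : R => `[a + c, b + c]%classic (z + c) -> P (z + c)) := cont _ BP.
change (nbhs x (fun z : R => `[a, b]%classic z -> P (z + c))).
apply: filterS N => z Pz.
by rewrite /= in_itv/= => /andP[az zb]; apply: Pz; rewrite /= in_itv/= !lerD2r az.
Qed.

Lemma H1per_double L u du : 0 < L -> H1per L u du ->
  exists e, [/\ H1per (L + L) u e, {in `[0, L], e =1 du} &
    forall x, 0 < x <= L -> e (x + L) = e x].
Proof.
move=> L0 H; have L0' := ltW L0; have i := H1per_integrable H.
pose e t := if t <= L then du t else du (t - L).
have e1 x : x <= L -> e x = du x by rewrite /e => ->.
have eL x : 0 < x <= L -> e (x + L) = e x.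
  by move=> /andP[x0 xL]; rewrite /e xL ifF ?addrK//; lra.
have eL2 x : 0 < x <= L -> e (x + L) ^+ 2 = e x ^+ 2 by move=> /eL ->.
have ein : {in `[0, L], e =1 du} by move=> x; rewrite in_itv/= => /andP[_ /e1].
have ein' : {in `[0, L]%classic, e =1 du} by move=> x /set_mem; exact: ein.
exists e; split => //.
have [m i2 h pu] := H.
have ie : mu.-integrable `[0, L] (EFin \o e).
  by apply: eq_integrable i => // x xL /=; rewrite ein'.
have iee := @integrable_periodic R L e L0' eL ie.
split.
- apply: measurable_periodic => //.
  by apply: eq_measurable_fun m => x xL; rewrite ein'.
- apply: (@integrable_periodic R L (fun x => e x ^+ 2)) => //.
  by apply: eq_integrable i2 => // x xL /=; rewrite ein'.
- move=> x; rewrite in_itv/= => /andP[x0 x2L].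
  have [xL|/ltW xL] := leP x L.
    rewrite h ?in_itv/= ?x0//; congr (_ + _); apply: eq_Rintegral => y /set_mem.
    by rewrite /= in_itv/= => /andP[y0 yx]; rewrite e1// (le_trans yx).
  rewrite (@Rintegral_itv_split _ 0 L x)//; last exact: integrable_itvS iee.
  have := @Rintegral_periodic_tail R L e L0' eL (x - L).
  rewrite subrK => ->//; last by rewrite subr_ge0 xL lerBlDr.
  rewrite -[x in LHS](subrK L) pu h ?in_itv/= ?subr_ge0 ?xL ?lerBlDr//.
  have : u L = u 0 by rewrite -[in LHS](add0r L) pu.
  rewrite h ?in_itv/= ?lexx ?L0'// => /eqP; rewrite -subr_eq0 addrC addKr => /eqP du0.
  rewrite (_ : \int[mu]_(t in `[0, L]) e t = \int[mu]_(t in `[0, L]) du t); last first.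
    exact: eq_Rintegral.
  rewrite du0 add0r; congr (_ + _); apply: eq_Rintegral => y /set_mem.
  rewrite /= in_itv/= => /andP[y0 yx]; rewrite e1// (le_trans yx)//.
  by rewrite lerBlDr.
- by move=> x; rewrite addrA !pu.
Qed.

Lemma le_Rintegral_itv_oo (a b : R) (f g : R -> R) :
  mu.-integrable `[a, b] (EFin \o f) -> mu.-integrable `[a, b] (EFin \o g) ->
  (\int[mu]_(x in `]a, b[) (f x)%:E <= \int[mu]_(x in `]a, b[) (g x)%:E)%E ->
  \int[mu]_(x in `[a, b]) f x <= \int[mu]_(x in `[a, b]) g x.
Proof.
move=> fi gi le.
have sub : `]a, b[%classic `<=` `[a, b]%classic by apply: subset_itv; rewrite bnd_simp.
have mf : measurable_fun `]a, b[ (fun x => (f x)%:E).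
  by apply: measurable_funS (measurable_int mu fi).
have mg : measurable_fun `]a, b[ (fun x => (g x)%:E).
  by apply: measurable_funS (measurable_int mu gi).
rewrite -lee_fin !fineK; [|exact: integrable_fin_num..].
by rewrite [leLHS]integral_itv_bndoo// [leRHS]integral_itv_bndoo.
Qed.

Lemma H1per_abs_increment L u du x y : H1per L u du -> 0 <= x -> x <= y -> y <= L ->
  (`|u y - u x|%:E <= \int[mu]_(t in `[x, y]) `|du t|%:E)%E.
Proof.
move=> H x0 xy yL; rewrite (H1per_increment H)//.
have i := integrable_itvS x0 yL (H1per_integrable H).
rewrite EFin_normr_Rintegral//; apply: (le_abse_integral mu (measurable_itv _)).
exact: measurable_int i.
Qed.

Lemma H1per_sub_cst L u du (k : R) : H1per L u du -> H1per L (fun x => u x - k) du.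
Proof.
move=> H; have := H1per_lin 1 (- 1) H (H1per_cst L k).
under eq_fun do rewrite mul1r mulN1r.
by under [X in H1per _ _ X]eq_fun do rewrite mul1r mulr0 addr0.
Qed.

Lemma H1per_quarter L u du p q : H1per L u du -> 0 <= p -> p + pi / 2 <= L ->
  q = p \/ q = p + pi / 2 ->
  \int[mu]_(x in `[p, p + pi / 2]) ((u x - u q) ^+ 2) <=
  \int[mu]_(x in `[p, p + pi / 2]) (du x ^+ 2).
Proof.
move=> H p0 pL pq.
have pi0 : p <= p + pi / 2 by rewrite lerDl divr_ge0// pi_ge0.
have L0 : 0 <= L by rewrite (le_trans p0)// (le_trans pi0).
have Hq := H1per_sub_cst (u q) H.
apply: le_Rintegral_itv_oo.
- exact: integrable_itvS p0 pL (H1per_integrable_sqr L0 Hq).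
- exact: integrable_itvS p0 pL (H1per_L2 H).
have sub : `]p, p + pi / 2[%classic `<=` `[0, L]%classic.
  by apply: subset_itv; rewrite bnd_simp.
have mdu : measurable_fun `]p, p + pi / 2[ du.
  by apply: measurable_funS (H1per_measurable H).
have mu_ : measurable_fun `]p, p + pi / 2[ (fun x => u x - u q).
  apply: measurable_funS (_ : measurable_fun `[0, L] _) => //.
  by apply/measurable_EFinP; exact: measurable_int (H1per_integrable_fun L0 Hq).
case: pq => qE; subst q; [apply: quarter_left|apply: quarter_right] => //.
- move=> x /andP[/ltW px /ltW xp].
  by apply: H1per_abs_increment H p0 px _; exact: le_trans xp _.
- move=> x /andP[/ltW px /ltW xp]; rewrite distrC.
  by apply: H1per_abs_increment H _ xp pL; exact: le_trans px.
Qed.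

(* [u] takes the same value [k] at two antipodal points [c], [c + pi]; on each of the
   four quarter periods starting or ending there [u - k] vanishes at one end. *)
Lemma wirtinger u du : H1per (2 * pi) u du -> \int[mu]_(x in `[0, 2 * pi]) u x = 0 ->
  \int[mu]_(x in `[0, 2 * pi]) (u x ^+ 2) <= \int[mu]_(x in `[0, 2 * pi]) (du x ^+ 2).
Proof.
move=> H u0; set L := 2 * pi in H u0 *.
have pi0 : 0 < pi :> R by exact: pi_gt0.
have LE : L = pi + pi by rewrite /L; ring.
have L0 : 0 < L by rewrite LE addr_gt0.
have L0' := ltW L0.
have [e [He ein eL]] := H1per_double L0 H.
have pu : forall x, u (x + L) = u x by case: H.
have cu := H1per_continuous (addr_ge0 L0' L0') He.
have [c cpi cE] : exists2 c, c \in `[0, pi] & u c - u (c + pi) = 0.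
  apply: (@IVT _ (fun x => u x - u (x + pi))); first exact: ltW.
    have c1 : {within `[0, pi], continuous u}.
      by apply: continuous_subspaceW cu; apply: sub_itv_cc => //; rewrite LE; lra.
    have c2 : {within `[0, pi], continuous (fun x => u (x + pi))}.
      apply: within_continuous_addr; apply: continuous_subspaceW cu.
      by apply: sub_itv_cc; rewrite ?LE; lra.
    by move=> x; apply: cvgB; [exact: c1|exact: c2].
  have -> : u (pi + pi) = u 0 by rewrite -LE -[in LHS](add0r L) pu.
  rewrite add0r -[u pi - u 0]opprB ge_min le_max oppr_le0 oppr_ge0.
  by apply/andP; split; apply/orP; case/orP: (le_total (u 0 - u pi) 0) => h;
    first [left; exact: h|right; exact: h].
move: cpi; rewrite in_itv/= => /andP[c0 cp].
have cE' : u (c + pi) = u c by apply/esym/eqP; rewrite -subr_eq0 cE.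
have cE2 : u (c + pi + pi) = u c by rewrite -addrA -LE pu.
pose k := u c.
have q1 := @H1per_quarter (L + L) u e c c He c0 _ (or_introl erefl).
have q2 := @H1per_quarter (L + L) u e (c + pi / 2) (c + pi) He _ _ (or_intror _).
have q3 := @H1per_quarter (L + L) u e (c + pi) (c + pi) He _ _ (or_introl erefl).
have q4 := @H1per_quarter (L + L) u e (c + pi + pi / 2) (c + pi + pi) He _ _ (or_intror _).
have pE (x : R) : x + pi / 2 + pi / 2 = x + pi by field.
rewrite -/k in q1; rewrite cE' -/k !pE in q2; rewrite cE' -/k in q3; rewrite cE2 -/k !pE in q4.
have Hk := H1per_sub_cst k He.
have ik := H1per_integrable_sqr (addr_ge0 L0' L0') Hk.
have ie := H1per_L2 He.
have split4 (f : R -> R) : mu.-integrable `[0, L + L] (EFin \o f) ->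
    \int[mu]_(x in `[c, c + L]) f x =
    (\int[mu]_(x in `[c, c + pi / 2]) f x + \int[mu]_(x in `[c + pi / 2, c + pi]) f x) +
    (\int[mu]_(x in `[c + pi, c + pi + pi / 2]) f x
      + \int[mu]_(x in `[c + pi + pi / 2, c + pi + pi]) f x).
  move=> i.
  have E0 : c + L = c + pi + pi by rewrite LE addrA.
  have i0 : mu.-integrable `[c, c + pi + pi] (EFin \o f).
    by apply: integrable_itvS i; rewrite ?LE; (clear -pi0 c0 cp; lra).
  have i1 : mu.-integrable `[c, c + pi] (EFin \o f).
    by apply: integrable_itvS i0; (clear -pi0 c0 cp; lra).
  have i2 : mu.-integrable `[c + pi, c + pi + pi] (EFin \o f).
    by apply: integrable_itvS i0; (clear -pi0 c0 cp; lra).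
  have s1 : c <= c + pi by (clear -pi0 c0 cp; lra).
  have s2 : c + pi <= c + pi + pi by (clear -pi0 c0 cp; lra).
  have s3 : c <= c + pi / 2 by (clear -pi0 c0 cp; lra).
  have s4 : c + pi / 2 <= c + pi by (clear -pi0 c0 cp; lra).
  have s5 : c + pi <= c + pi + pi / 2 by (clear -pi0 c0 cp; lra).
  have s6 : c + pi + pi / 2 <= c + pi + pi by (clear -pi0 c0 cp; lra).
  by rewrite E0 (Rintegral_itv_split s1 s2 i0) (Rintegral_itv_split s3 s4 i1)
    (Rintegral_itv_split s5 s6 i2).
have main : \int[mu]_(x in `[c, c + L]) ((u x - k) ^+ 2) <= \int[mu]_(x in `[c, c + L]) (e x ^+ 2).
  rewrite !split4//; apply: lerD; apply: lerD.
  - by apply: q1; rewrite LE; (clear -pi0 c0 cp; lra).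
  - by apply: q2; rewrite ?LE; (clear -pi0 c0 cp; lra).
  - by apply: q3; rewrite ?LE; (clear -pi0 c0 cp; lra).
  - by apply: q4; rewrite ?LE; (clear -pi0 c0 cp; lra).
have cL : 0 <= c <= L by rewrite c0 LE; (clear -pi0 c0 cp; lra).
have sub (f : R -> R) :
    mu.-integrable `[0, L + L] (EFin \o f) -> mu.-integrable `[0, L] (EFin \o f).
  by apply: integrable_itvS => //; rewrite lerDl.
have eL2 x : 0 < x <= L -> e (x + L) ^+ 2 = e x ^+ 2 by move=> /eL ->.
have uL2 x : 0 < x <= L -> (u (x + L) - k) ^+ 2 = (u x - k) ^+ 2 by rewrite pu.
move: main; rewrite (Rintegral_periodic L0' eL2 cL (sub _ ie)).
rewrite (Rintegral_periodic L0' uL2 cL (sub _ ik)).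
rewrite [leRHS](@eq_Rintegral _ _ _ mu _ (fun x => du x ^+ 2)); last first.
  by move=> x /set_mem xL; rewrite ein.
apply: le_trans.
have iu := H1per_integrable_fun L0' H; have iu2 := H1per_integrable_sqr L0' H.
have mL : measurable `[0, L]%classic by [].
have ic (r : R) : mu.-integrable `[0, L] (EFin \o (fun=> r)).
  by apply: (within_itv_integrable (f := cst r)) => z; exact: cvg_cst.
rewrite (@eq_Rintegral _ _ _ mu _ (fun x => (u x ^+ 2 + (- 2 * k) * u x) + k ^+ 2)); last first.
  by move=> x _; ring.
rewrite RintegralD//; last first.
  by apply: (@integrable_add _ _ _ mu _ mL) => //; exact: (@integrable_scale _ _ _ mu _ mL).
rewrite RintegralD//; last exact: (@integrable_scale _ _ _ mu _ mL).
rewrite RintegralZl// u0 mulr0 addr0 Rintegral_itv_cst// subr0 lerDl.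
by rewrite mulr_ge0 ?sqr_ge0.
Qed.

End wirtinger.

(** * The constants K1 and K2 *)

Section constants.
Context (R : realType).
Notation mu := (@lebesgue_measure R).
Implicit Types (L : R) (u v du dv : R -> R).

Lemma Rintegral_energy L u du (g : R) : 0 <= L -> H1per L u du ->
  \int[mu]_(x in `[0, L]) (du x ^+ 2 + g * u x ^+ 2) =
  \int[mu]_(x in `[0, L]) (du x ^+ 2) + g * \int[mu]_(x in `[0, L]) (u x ^+ 2).
Proof.
move=> L0 H; have i := H1per_L2 H; have j := H1per_integrable_sqr L0 H.
have mL : measurable `[0, L]%classic by [].
rewrite RintegralD//; last exact: (@integrable_scale _ _ _ mu _ mL).
by rewrite RintegralZl.
Qed.

Lemma K1_bound (beta alpha : R) u du x : 0 < beta -> 0 < alpha ->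
  H1per (2 * pi / alpha) u du -> 0 <= x <= 2 * pi / alpha ->
  u x ^+ 2 <= K1 beta *
   (Num.sqrt (\int[mu]_(x in `[0, 2 * pi / alpha])
                      (du x ^+ 2 + alpha ^+ 2 * beta * u x ^+ 2))
        * Num.sqrt (\int[mu]_(x in `[0, 2 * pi / alpha]) (u x ^+ 2))).
Proof.
move=> b0 a0 H xL.
have pi0 : 0 < pi :> R by exact: pi_gt0.
have Lgt0 (a : R) : 0 < a -> 0 < 2 * pi / a by move=> ?; rewrite divr_gt0 ?mulr_gt0.
apply: (le_trans (sqr_le_supnorm (Lgt0 _ a0) H xL)).
apply: le_inf_mul; last 2 first.
- by rewrite mulr_ge0.
- by move=> K hK; rewrite mulrA; exact: hK a0 H.
exists (4 + (pi * Num.sqrt beta)^-1) => a v dv {}a0 {}H.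
have L0 := Lgt0 _ a0.
apply: supnorm_sqr_le => [|y yL]; first exact: ltW.
apply: (le_trans (H1per_agmon L0 H yL)).
rewrite (Rintegral_energy _ (ltW L0) H).
set L := 2 * pi / a in H yL L0 *.
set B := \int[mu]_(t in _) (v t ^+ 2); set D := \int[mu]_(t in _) (dv t ^+ 2).
have D0 : 0 <= D by apply: Rintegral_ge0 => z _; exact: sqr_ge0.
have B0 : 0 <= B by apply: Rintegral_ge0 => z _; exact: sqr_ge0.
rewrite mulrC ler_wpM2r//.
have sb0 : 0 < Num.sqrt beta by rewrite sqrtr_gt0.
have DE : Num.sqrt D <= Num.sqrt (D + a ^+ 2 * beta * B).
  by apply: ler_wsqrtr; rewrite lerDl !mulr_ge0 ?sqr_ge0// ltW.
have BE : a * Num.sqrt beta * Num.sqrt B <= Num.sqrt (D + a ^+ 2 * beta * B).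
  have -> : a * Num.sqrt beta * Num.sqrt B = Num.sqrt (a ^+ 2 * beta * B).
    have ab0 : 0 <= a ^+ 2 * beta by rewrite mulr_ge0 ?sqr_ge0// ltW.
    by rewrite (sqrtrM _ ab0) (sqrtrM _ (sqr_ge0 a)) sqrtr_sqr gtr0_norm.
  by apply: ler_wsqrtr; rewrite lerDr.
rewrite [leRHS]mulrDl; apply: lerD; first by rewrite ler_pM2l.
have -> : 2 / L * Num.sqrt B = (pi * Num.sqrt beta)^-1 * (a * Num.sqrt beta * Num.sqrt B).
  rewrite /L; move: pi0 sb0; move: (pi : R) (Num.sqrt beta) (Num.sqrt B) => p s t p0 s0.
  by field; rewrite !gt_eqF.
by rewrite ler_wpM2l// invr_ge0 mulr_ge0// ltW.
Qed.

Lemma K2_bound (beta : R) u du x : 0 <= beta < 1 ->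
  H1per (2 * pi) u du -> \int[mu]_(x in `[0, 2 * pi]) u x = 0 -> 0 <= x <= 2 * pi ->
  u x ^+ 2 <= K2 beta *
   (Num.sqrt (\int[mu]_(x in `[0, 2 * pi]) (du x ^+ 2 - beta * u x ^+ 2))
        * Num.sqrt (\int[mu]_(x in `[0, 2 * pi]) (u x ^+ 2))).
Proof.
move=> /andP[b0 b1] H u0 xL.
have pi0 : 0 < pi :> R by exact: pi_gt0.
have L0 : 0 < 2 * pi :> R by rewrite mulr_gt0.
apply: (le_trans (sqr_le_supnorm L0 H xL)).
apply: le_inf_mul; last 2 first.
- by rewrite mulr_ge0.
- by move=> K hK; rewrite mulrA; exact: hK H u0.
exists ((4 + 2 / (2 * pi)) / Num.sqrt (1 - beta)) => v dv {}H v0.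
apply: supnorm_sqr_le => [|y yL]; first exact: ltW.
apply: (le_trans (H1per_agmon L0 H yL)).
have W := wirtinger H v0.
have := Rintegral_energy (- beta) (ltW L0) H.
under [X in X = _ -> _]eq_Rintegral do rewrite mulNr.
move=> ->; move: W.
set B := \int[mu]_(t in _) (v t ^+ 2); set D := \int[mu]_(t in _) (dv t ^+ 2) => W.
have B0 : 0 <= B by apply: Rintegral_ge0 => z _; exact: sqr_ge0.
rewrite mulrC ler_wpM2r//.
have sb0 : 0 < Num.sqrt (1 - beta) by rewrite sqrtr_gt0 subr_gt0.
have BD : Num.sqrt B <= Num.sqrt D by exact: ler_wsqrtr.
apply: (@le_trans _ _ ((4 + 2 / (2 * pi)) * Num.sqrt D)).
  by rewrite [leRHS]mulrDl lerD2l ler_wpM2l// divr_ge0// ltW.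
rewrite -[leRHS]mulrA; apply: ler_wpM2l; first by rewrite addr_ge0// divr_ge0// ltW.
rewrite mulrC ler_pdivlMr// -sqrtrM; last by rewrite (le_trans B0).
apply: ler_wsqrtr; rewrite mulrBr mulr1 mulNr lerD2l lerN2.
by rewrite [leRHS]mulrC ler_wpM2l.
Qed.

Lemma energy_ge0 (beta : R) u du : 0 <= beta <= 1 ->
  H1per (2 * pi) u du -> \int[mu]_(x in `[0, 2 * pi]) u x = 0 ->
  0 <= \int[mu]_(x in `[0, 2 * pi]) (du x ^+ 2 - beta * u x ^+ 2).
Proof.
move=> /andP[b0 b1] H u0; have W := wirtinger H u0.
have := Rintegral_energy (- beta) (mulr_ge0 (ler0n _ 2) (pi_ge0 R)) H.
under [X in X = _ -> _]eq_Rintegral do rewrite mulNr.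
move=> ->; rewrite mulNr subr_ge0; apply: le_trans W.
by rewrite ler_piMl// Rintegral_ge0// => z _; exact: sqr_ge0.
Qed.

End constants.

(** * Traces and Gram matrices *)

Section trace.
Context (C : numClosedFieldType) (N : nat).
Local Open Scope sesquilinear_scope.
Implicit Types (A E P X : 'M[C]_N) (xi : 'rV[C]_N).

Lemma row_form P X i :
  (row i P *m X *m (row i P)^t*) 0 0 = (P *m X *m P^t*) i i.
Proof.
rewrite -row_mul [LHS]mxE [RHS]mxE; apply: eq_bigr => k _.
by congr (_ * _); rewrite !mxE.
Qed.

(* Evaluate the hypothesis at the rows of a unitary matrix diagonalizing [A], multiply by the
   eigenvalue and sum. *)
Lemma mxtrace_cube_le A E (k : C) : A^t* = A ->
  (forall xi, 0 <= (xi *m A *m xi^t*) 0 0) ->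
  (forall xi, (xi *m A *m xi^t*) 0 0 ^+ 2 <=
     k * (xi *m E *m xi^t*) 0 0 * (xi *m xi^t*) 0 0) ->
  \tr (A *m A *m A) <= k * \tr (A *m E).
Proof.
move=> Ah A0 AE.
have Anorm : A \is normalmx by apply/normalmxP; rewrite Ah.
have Pu := spectral_unitarymx A; move/orthomx_spectralP: Anorm.
rewrite invmx_unitary//; set P := spectralmx A in Pu *; set D := spectral_diag A => AD.
have PP : P *m P^t* = 1%:M by apply/unitarymxP.
have PAP : P *m A *m P^t* = diag_mx D.
  by rewrite AD !mulmxA PP mul1mx -!mulmxA PP mulmx1.
have dE i : (row i P *m A *m (row i P)^t*) 0 0 = D 0 i.
  by rewrite row_form PAP mxE eqxx mulr1n.
have nE i : (row i P *m (row i P)^t*) 0 0 = 1.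
  by have := row_form P 1%:M i; rewrite !mulmx1 PP => ->; rewrite mxE eqxx.
have trX X : \tr (A *m X) = \sum_i D 0 i * (P *m X *m P^t*) i i.
  rewrite {1}AD -!mulmxA mxtrace_mulC -!mulmxA /mxtrace; apply: eq_bigr => i _.
  by rewrite mul_diag_mx mxE !mulmxA.
rewrite -mulmxA !trX mulr_sumr; apply: ler_sum => i _.
have -> : P *m (A *m A) *m P^t* = diag_mx D *m diag_mx D.
  transitivity (P *m A *m (P^t* *m P) *m A *m P^t*); last by rewrite -PAP !mulmxA.
  by rewrite (mulmx1C PP) mulmx1 !mulmxA.
rewrite mul_diag_mx mxE mxE eqxx mulr1n [leRHS]mulrCA.
apply: ler_wpM2l; first by rewrite -dE.
rewrite -expr2 -row_form.
by have := AE (row i P); rewrite dE nE mulr1.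
Qed.

End trace.

Section cintegral.
Context (R : realType).
Notation mu := (@lebesgue_measure R).
Notation Re := complex.Re.
Notation Im := complex.Im.
Implicit Types (f g : R -> R[i]) (z w : R[i]).

Lemma complexReD z w : Re (z + w) = Re z + Re w. Proof. by case: z; case: w. Qed.
Lemma complexImD z w : Im (z + w) = Im z + Im w. Proof. by case: z; case: w. Qed.
Lemma complexReM z w : Re (z * w) = Re z * Re w - Im z * Im w. Proof. by case: z; case: w. Qed.
Lemma complexImM z w : Im (z * w) = Re z * Im w + Im z * Re w. Proof. by case: z; case: w. Qed.

Lemma complexRe_sum (I : Type) (r : seq I) (F : I -> R[i]) :
  Re (\sum_(i <- r) F i) = \sum_(i <- r) Re (F i).
Proof. by apply: (big_morph (@complex.Re R)) => // z w; exact: complexReD. Qed.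

Lemma complexIm_sum (I : Type) (r : seq I) (F : I -> R[i]) :
  Im (\sum_(i <- r) F i) = \sum_(i <- r) Im (F i).
Proof. by apply: (big_morph (@complex.Im R)) => // z w; exact: complexImD. Qed.

Lemma sqr_normcE z : Normc.normc z ^+ 2 = Re z ^+ 2 + Im z ^+ 2.
Proof. by case: z => a b /=; rewrite sqr_sqrtr// addr_ge0// sqr_ge0. Qed.

Lemma mulcJ z : z * z^*%C = (Normc.normc z ^+ 2)%:C%C.
Proof.
by rewrite sqr_normcE; case: z => a b; apply/eqP; rewrite eq_complex /=; apply/andP; split;
  apply/eqP; ring.
Qed.

Definition cintegrable (D : set R) f :=
  mu.-integrable D (EFin \o (fun x => Re (f x))) /\
  mu.-integrable D (EFin \o (fun x => Im (f x))).

Section linearity.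
Context (D : set R) (mD : measurable D).

Lemma cintegrableZ f z : cintegrable D f -> cintegrable D (fun x => z * f x).
Proof.
move=> [fr fi]; split.
  have := @integrable_add _ _ _ mu _ mD _ _ (@integrable_scale _ _ _ mu _ mD _ (Re z) fr)
    (@integrable_scale _ _ _ mu _ mD _ (- Im z) fi).
  by apply: eq_integrable => // x _ /=; rewrite complexReM mulNr.
have := @integrable_add _ _ _ mu _ mD _ _ (@integrable_scale _ _ _ mu _ mD _ (Re z) fi)
  (@integrable_scale _ _ _ mu _ mD _ (Im z) fr).
by apply: eq_integrable => // x _ /=; rewrite complexImM.
Qed.

Lemma cintegralZ f z : cintegrable D f ->
  cintegral D (fun x => z * f x) = z * cintegral D f.
Proof.
move=> [fr fi]; apply/eqP; rewrite eq_complex complexReM complexImM /=.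
apply/andP; split; apply/eqP.
  rewrite -!RintegralZl// -RintegralB//; [|exact: (@integrable_scale _ _ _ mu _ mD)..].
  by apply: eq_Rintegral => x _; rewrite complexReM.
rewrite -!RintegralZl// -RintegralD//; [|exact: (@integrable_scale _ _ _ mu _ mD)..].
by apply: eq_Rintegral => x _; rewrite complexImM.
Qed.

Lemma cintegrableD f g : cintegrable D f -> cintegrable D g ->
  cintegrable D (fun x => f x + g x).
Proof.
move=> [fr fi] [gr gi]; split.
  have := @integrable_add _ _ _ mu _ mD _ _ fr gr.
  by apply: eq_integrable => // x _ /=; rewrite complexReD.
have := @integrable_add _ _ _ mu _ mD _ _ fi gi.
by apply: eq_integrable => // x _ /=; rewrite complexImD.
Qed.

Lemma cintegralD f g : cintegrable D f -> cintegrable D g ->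
  cintegral D (fun x => f x + g x) = cintegral D f + cintegral D g.
Proof.
move=> [fr fi] [gr gi]; apply/eqP; rewrite eq_complex complexReD complexImD /=.
apply/andP; split; apply/eqP.
  by rewrite -RintegralD//; apply: eq_Rintegral => x _; rewrite complexReD.
by rewrite -RintegralD//; apply: eq_Rintegral => x _; rewrite complexImD.
Qed.

Lemma cintegrable0 : cintegrable D (fun=> 0).
Proof. by split; exact: integrable0. Qed.

Lemma cintegral0 : cintegral D (fun=> 0 : R[i]) = 0.
Proof.
by apply/eqP; rewrite eq_complex /=; rewrite /Rintegral integral0 eqxx.
Qed.

Lemma eq_cintegral f g : (forall x, D x -> f x = g x) -> cintegral D f = cintegral D g.
Proof.
by move=> fg; congr Complex; apply: eq_Rintegral => x /set_mem Dx; rewrite fg.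
Qed.

Lemma cintegrable_sum (I : Type) (r : seq I) (F : I -> R -> R[i]) :
  (forall i, cintegrable D (F i)) -> cintegrable D (fun x => \sum_(i <- r) F i x).
Proof.
move=> h; elim: r => [|i r IH]; first by under eq_fun do rewrite big_nil; exact: cintegrable0.
by under eq_fun do rewrite big_cons; exact: cintegrableD.
Qed.

Lemma cintegral_sum (I : Type) (r : seq I) (F : I -> R -> R[i]) :
  (forall i, cintegrable D (F i)) ->
  cintegral D (fun x => \sum_(i <- r) F i x) = \sum_(i <- r) cintegral D (F i).
Proof.
move=> h; elim: r => [|i r IH].
  by rewrite big_nil -[RHS]cintegral0; apply: eq_cintegral => x _; rewrite big_nil.
rewrite big_cons -IH -cintegralD//; last exact: cintegrable_sum.
by apply: eq_cintegral => x _; rewrite big_cons.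
Qed.

Lemma le_cintegral f g : cintegrable D f -> cintegrable D g ->
  (forall x, D x -> f x <= g x) -> cintegral D f <= cintegral D g.
Proof.
move=> [fr fi] [gr gi] fg; rewrite lecE /=; apply/andP; split.
  by apply/eqP/eq_Rintegral => x /set_mem /fg; rewrite lecE => /andP[/eqP].
by apply: le_Rintegral => // x /fg; rewrite lecE => /andP[].
Qed.

Definition cL2 f :=
  [/\ measurable_fun D (fun x => Re (f x)), measurable_fun D (fun x => Im (f x)),
    mu.-integrable D (fun x => (Re (f x) ^+ 2)%:E) &
    mu.-integrable D (fun x => (Im (f x) ^+ 2)%:E)].

Lemma cintegrable_mulJ f g : cL2 f -> cL2 g -> cintegrable D (fun x => f x * (g x)^*%C).
Proof.
move=> [mfr mfi ifr ifi] [mgr mgi igr igi].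
have p1 := @integrable_mul_L2 _ _ _ mu _ mD _ _ mfr mgr ifr igr.
have p2 := @integrable_mul_L2 _ _ _ mu _ mD _ _ mfi mgi ifi igi.
have p3 := @integrable_mul_L2 _ _ _ mu _ mD _ _ mfi mgr ifi igr.
have p4 := @integrable_mul_L2 _ _ _ mu _ mD _ _ mfr mgi ifr igi.
split.
  have := @integrable_add _ _ _ mu _ mD _ _ p1 p2.
  apply: eq_integrable => // x _ /=; rewrite complexReM; congr EFin.
  by case: (f x); case: (g x) => a b c d /=; ring.
have := @integrable_add _ _ _ mu _ mD _ _ p3 (@integrable_scale _ _ _ mu _ mD _ (-1) p4).
apply: eq_integrable => // x _ /=; rewrite complexImM; congr EFin.
by case: (f x); case: (g x) => a b c d /=; ring.
Qed.

Lemma cintegral_mulJ f :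
  cintegral D (fun x => f x * (f x)^*%C) = (\int[mu]_(x in D) (Normc.normc (f x) ^+ 2))%:C%C.
Proof.
apply/eqP; rewrite eq_complex /=; apply/andP; split; apply/eqP.
  by apply: eq_Rintegral => x _; rewrite mulcJ.
rewrite (@eq_Rintegral _ _ _ mu _ (fun=> 0)) ?Rintegral_cst ?mul0r// => x _.
by rewrite mulcJ.
Qed.

End linearity.

Definition ccontinuous (L : R) f :=
  {within `[0, L], continuous (fun x => Re (f x))} /\
  {within `[0, L], continuous (fun x => Im (f x))}.

Lemma eq_within_continuous (A : set R) (f g : R -> R) : f =1 g ->
  {within A, continuous f} -> {within A, continuous g}.
Proof. by move=> /funext ->. Qed.

Lemma ccontinuousD L f g : ccontinuous L f -> ccontinuous L g ->
  ccontinuous L (fun x => f x + g x).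
Proof.
move=> [fr fi] [gr gi]; split.
  exact: eq_within_continuous (fun x => esym (complexReD _ _)) (within_continuous_add fr gr).
exact: eq_within_continuous (fun x => esym (complexImD _ _)) (within_continuous_add fi gi).
Qed.

Lemma ccontinuous_cst L z : ccontinuous L (fun=> z).
Proof. by split; move=> x; exact: cvg_cst. Qed.

Lemma ccontinuousM L f g : ccontinuous L f -> ccontinuous L g ->
  ccontinuous L (fun x => f x * g x).
Proof.
move=> [fr fi] [gr gi]; split.
  apply: (@eq_within_continuous _ (fun x => Re (f x) * Re (g x) + -1 * (Im (f x) * Im (g x)))).
    by move=> x; rewrite complexReM mulN1r.
  apply: within_continuous_add; first exact: within_continuous_mul.
  apply: within_continuous_mul; first by move=> x; exact: cvg_cst.
  exact: within_continuous_mul.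
apply: (@eq_within_continuous _ (fun x => Re (f x) * Im (g x) + Im (f x) * Re (g x))).
  by move=> x; rewrite complexImM.
by apply: within_continuous_add; exact: within_continuous_mul.
Qed.

Lemma ccontinuousJ L f : ccontinuous L f -> ccontinuous L (fun x => (f x)^*%C).
Proof.
move=> [fr fi]; split.
  by apply: eq_within_continuous fr => x; case: (f x).
apply: (@eq_within_continuous _ (fun x => -1 * Im (f x))).
  by move=> x; case: (f x) => a b /=; rewrite mulN1r.
by apply: within_continuous_mul => // x; exact: cvg_cst.
Qed.

Lemma ccontinuous_sum L (I : Type) (r : seq I) (F : I -> R -> R[i]) :
  (forall i, ccontinuous L (F i)) -> ccontinuous L (fun x => \sum_(i <- r) F i x).
Proof.
move=> h; elim: r => [|i r IH].
  by under eq_fun do rewrite big_nil; exact: ccontinuous_cst.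
by under eq_fun do rewrite big_cons; exact: ccontinuousD.
Qed.

Lemma ccontinuous_integrable L f : ccontinuous L f -> cintegrable `[0, L] f.
Proof. by move=> [fr fi]; split; exact: within_itv_integrable. Qed.

Lemma H1perC_continuous L f df : 0 <= L -> H1perC L f df -> ccontinuous L f.
Proof.
move=> L0 [hr hi]; split; first exact: (H1per_continuous L0 hr).
exact: (H1per_continuous L0 hi).
Qed.

Lemma H1perC_L2 L f df : H1perC L f df -> cL2 `[0, L] df.
Proof. by move=> [[? ? _ _] [? ? _ _]]; split. Qed.

Lemma H1perC_L2_fun L f df : 0 <= L -> H1perC L f df -> cL2 `[0, L] f.
Proof.
move=> L0 [hr hi]; split.
- by apply/measurable_EFinP; exact: measurable_int (H1per_integrable_fun L0 hr).
- by apply/measurable_EFinP; exact: measurable_int (H1per_integrable_fun L0 hi).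
- exact: H1per_integrable_sqr hr.
- exact: H1per_integrable_sqr hi.
Qed.

End cintegral.

Section gram.
Context (R : realType) (N M : nat) (L : R).
Notation mu := (@lebesgue_measure R).
Notation Re := complex.Re.
Notation Im := complex.Im.
Implicit Types (f : 'I_N -> R -> 'cV[R[i]]_M) (xi : 'rV[R[i]]_N).

Definition comb f xi (j : 'I_M) (x : R) : R[i] := \sum_(n < N) xi 0 n * f n x j 0.

Definition gram_at f (x : R) : 'M[R[i]]_N :=
  \matrix_(n, m) \sum_(j < M) f n x j 0 * (f m x j 0)^*%C.

Definition gram f : 'M[R[i]]_N :=
  \matrix_(n, m) \sum_(j < M) cintegral `[0, L] (fun x => f n x j 0 * (f m x j 0)^*%C).

Local Open Scope sesquilinear_scope.

Lemma form_sum (X : 'M[R[i]]_N) xi :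
  (xi *m X *m xi^t*) 0 0 = \sum_n \sum_m xi 0 n * (xi 0 m)^*%C * X n m.
Proof.
rewrite mxE exchange_big /=; apply: eq_bigr => m _; rewrite !mxE mulr_suml.
by apply: eq_bigr => n _; rewrite mulrAC.
Qed.

Lemma comb_mulJ f xi j x : comb f xi j x * (comb f xi j x)^*%C =
  \sum_n \sum_m xi 0 n * (xi 0 m)^*%C * (f n x j 0 * (f m x j 0)^*%C).
Proof.
rewrite /comb rmorph_sum mulr_suml; apply: eq_bigr => n _; rewrite mulr_sumr.
by apply: eq_bigr => m _; rewrite rmorphM /=; ring.
Qed.

Lemma gram_at_form f xi x : (xi *m gram_at f x *m xi^t*) 0 0 =
  (\sum_j Normc.normc (comb f xi j x) ^+ 2)%:C%C.
Proof.
rewrite form_sum rmorph_sum /=.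
under [RHS]eq_bigr do rewrite -mulcJ comb_mulJ.
rewrite [RHS]exchange_big; apply: eq_bigr => n _; rewrite exchange_big; apply: eq_bigr => m _.
by rewrite mxE mulr_sumr.
Qed.

Lemma gram_form f xi : (forall n j, cL2 `[0, L] (fun x => f n x j 0)) ->
  (xi *m gram f *m xi^t*) 0 0 =
  (\sum_j \int[mu]_(x in `[0, L]) (Normc.normc (comb f xi j x) ^+ 2))%:C%C.
Proof.
move=> f2; have mL : measurable `[0, L]%classic by [].
have i2 n m j : cintegrable `[0, L] (fun x => f n x j 0 * (f m x j 0)^*%C).
  exact: cintegrable_mulJ.
rewrite form_sum rmorph_sum /=.
have cE j : (\int[mu]_(x in `[0, L]) (Normc.normc (comb f xi j x) ^+ 2))%:C%C =
    \sum_n \sum_m xi 0 n * (xi 0 m)^*%C * cintegral `[0, L] (fun x => f n x j 0 * (f m x j 0)^*%C).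
  rewrite -cintegral_mulJ//.
  transitivity (cintegral `[0, L]
      (fun x => \sum_n \sum_m xi 0 n * (xi 0 m)^*%C * (f n x j 0 * (f m x j 0)^*%C))).
    by apply: eq_cintegral => x _; exact: comb_mulJ.
  rewrite cintegral_sum//; last by move=> n; apply: cintegrable_sum => // m; exact: cintegrableZ.
  apply: eq_bigr => n _; rewrite cintegral_sum//; last by move=> m; exact: cintegrableZ.
  by apply: eq_bigr => m _; exact: cintegralZ.
under [RHS]eq_bigr do rewrite cE.
rewrite [RHS]exchange_big; apply: eq_bigr => n _; rewrite exchange_big; apply: eq_bigr => m _.
by rewrite mxE mulr_sumr.
Qed.

Lemma gram_at_herm f x : (gram_at f x)^t* = gram_at f x.
Proof.
apply/matrixP => n m; rewrite !mxE rmorph_sum; apply: eq_bigr => j _.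
by rewrite rmorphM /= mulrC; congr (_ * _); exact: conjcK.
Qed.

Lemma mxtrace_Umx f x : \tr (Umx f x x ^+ 3) = \tr (gram_at f x *m gram_at f x *m gram_at f x).
Proof.
pose F : 'M[R[i]]_(N, M) := \matrix_(n, j) f n x j 0.
pose G : 'M[R[i]]_(M, N) := map_mx (@conjc R) F^T.
have -> : gram_at f x = F *m G.
  by apply/matrixP => n m; rewrite !mxE; apply: eq_bigr => j _; rewrite !mxE.
have -> : Umx f x x = (G *m F)^T.
  apply/matrixP => j k; rewrite /Umx summxE !mxE; apply: eq_bigr => n _.
  by rewrite !mxE big_ord1 !mxE mulrC.
rewrite exprS expr2 -!mulmxE -!trmx_mul mxtrace_tr.
by rewrite -!mulmxA [LHS]mxtrace_mulC !mulmxA.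
Qed.

Lemma cauchy_schwarz_sum (I : finType) (a e b : I -> R) (K : R) :
  (forall i, 0 <= a i) -> (forall i, 0 <= e i) -> (forall i, 0 <= b i) ->
  (forall i, a i <= K * (Num.sqrt (e i) * Num.sqrt (b i))) ->
  (\sum_i a i) ^+ 2 <= K ^+ 2 * (\sum_i e i) * (\sum_i b i).
Proof.
move=> a0 e0 b0 h.
have cs : (\sum_i Num.sqrt (e i) * Num.sqrt (b i)) ^+ 2 <= (\sum_i e i) * (\sum_i b i).
  apply: sqr_le_mul_of_quadratic => [|t]; first exact: sumr_ge0.
  have -> : (\sum_i e i) * t ^+ 2 + 2 * (\sum_i Num.sqrt (e i) * Num.sqrt (b i)) * t + \sum_i b i
      = \sum_i (Num.sqrt (e i) * t + Num.sqrt (b i)) ^+ 2.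
    rewrite mulr_suml -mulrA mulr_suml mulr_sumr -!big_split; apply: eq_bigr => i _ /=.
    by rewrite -{1}(sqr_sqrtr (e0 i)) -{2}(sqr_sqrtr (b0 i)); ring.
  by apply: sumr_ge0 => i _; exact: sqr_ge0.
have s0 : 0 <= \sum_i Num.sqrt (e i) * Num.sqrt (b i).
  by apply: sumr_ge0 => i _; rewrite mulr_ge0 ?sqrtr_ge0.
have le : \sum_i a i <= `|K| * \sum_i Num.sqrt (e i) * Num.sqrt (b i).
  rewrite mulr_sumr; apply: ler_sum => i _; apply: le_trans (h i) _.
  by rewrite ler_wpM2r ?ler_norm// mulr_ge0 ?sqrtr_ge0.
apply: (@le_trans _ _ ((`|K| * \sum_i Num.sqrt (e i) * Num.sqrt (b i)) ^+ 2)).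
  by rewrite ler_sqr ?nnegrE// ?sumr_ge0// mulr_ge0.
by rewrite exprMn real_normK ?num_real// -mulrA ler_wpM2l// sqr_ge0.
Qed.

End gram.

Section trace_inequality.
Context (R : realType) (N M : nat) (L g K : R) (phi dphi : 'I_N -> R -> 'cV[R[i]]_M).
Notation mu := (@lebesgue_measure R).
Notation Re := complex.Re.
Notation Im := complex.Im.
Context (Q : (R -> R) -> (R -> R) -> Prop) (L0 : 0 <= L).
Context (QH : forall u du, Q u du -> H1per L u du).
Context (Q0 : Q (fun=> 0) (fun=> 0)).
Context (Qlin : forall u v du dv (a b : R), Q u du -> Q v dv ->
  Q (fun x => a * u x + b * v x) (fun x => a * du x + b * dv x)).
Context (Qre : forall n j, Q (fun x => Re (phi n x j 0)) (fun x => Re (dphi n x j 0))).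
Context (Qim : forall n j, Q (fun x => Im (phi n x j 0)) (fun x => Im (dphi n x j 0))).
Context (QE : forall u du, Q u du ->
  0 <= \int[mu]_(x in `[0, L]) (du x ^+ 2 + g * u x ^+ 2)).
Context (QK : forall u du x, Q u du -> 0 <= x <= L ->
  u x ^+ 2 <= K * (Num.sqrt (\int[mu]_(x in `[0, L]) (du x ^+ 2 + g * u x ^+ 2)) *
    Num.sqrt (\int[mu]_(x in `[0, L]) (u x ^+ 2)))).
Context (phi_on : orthonormal_family L phi).

Let HC n j : H1perC L (fun x => phi n x j 0) (fun x => dphi n x j 0).
Proof. by split; apply: QH. Qed.

Let phi2 n j : cL2 `[0, L] (fun x => phi n x j 0).
Proof. exact: H1perC_L2_fun (HC n j). Qed.

Let dphi2 n j : cL2 `[0, L] (fun x => dphi n x j 0).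
Proof. exact: H1perC_L2 (HC n j). Qed.

Lemma gram_orthonormal : gram L phi = 1%:M.
Proof. by apply/matrixP => n m; rewrite !mxE; exact: phi_on. Qed.

Lemma Q_sum (I : Type) (r : seq I) (u du : I -> R -> R) :
  (forall i, Q (u i) (du i)) ->
  Q (fun x => \sum_(i <- r) u i x) (fun x => \sum_(i <- r) du i x).
Proof.
move=> H; elim: r => [|i r IH].
  by under eq_fun do rewrite big_nil; under [X in Q _ X]eq_fun do rewrite big_nil.
under eq_fun do rewrite big_cons; under [X in Q _ X]eq_fun do rewrite big_cons.
have := Qlin 1 1 (H i) IH.
by under eq_fun do rewrite !mul1r; under [X in Q _ X]eq_fun do rewrite !mul1r.
Qed.

Lemma Q_comb_Re xi j : Q (fun x => Re (comb phi xi j x)) (fun x => Re (comb dphi xi j x)).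
Proof.
have E f : (fun x => Re (comb f xi j x)) =
    (fun x => \sum_(n < N) (Re (xi 0 n) * Re (f n x j 0) + - Im (xi 0 n) * Im (f n x j 0))).
  by apply/funext => x; rewrite complexRe_sum; apply: eq_bigr => n _; rewrite complexReM mulNr.
by rewrite !E; apply: Q_sum => n; exact: Qlin.
Qed.

Lemma Q_comb_Im xi j : Q (fun x => Im (comb phi xi j x)) (fun x => Im (comb dphi xi j x)).
Proof.
have E f : (fun x => Im (comb f xi j x)) =
    (fun x => \sum_(n < N) (Re (xi 0 n) * Im (f n x j 0) + Im (xi 0 n) * Re (f n x j 0))).
  by apply/funext => x; rewrite complexIm_sum; apply: eq_bigr => n _; rewrite complexImM.
by rewrite !E; apply: Q_sum => n; exact: Qlin.
Qed.

Lemma Rintegral_sqr_normc (f : R -> R[i]) : cL2 `[0, L] f ->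
  \int[mu]_(x in `[0, L]) (Normc.normc (f x) ^+ 2) =
  \int[mu]_(x in `[0, L]) (Re (f x) ^+ 2) + \int[mu]_(x in `[0, L]) (Im (f x) ^+ 2).
Proof.
move=> [_ _ fr fi]; rewrite -RintegralD//.
by apply: eq_Rintegral => x _; rewrite sqr_normcE.
Qed.

Definition energy_mx : 'M[R[i]]_N := gram L dphi + g%:C%C *: gram L phi.

Local Open Scope sesquilinear_scope.

Lemma form_inequality (x : R) (xi : 'rV[R[i]]_N) : 0 <= x <= L ->
  (xi *m gram_at phi x *m xi^t*) 0 0 ^+ 2 <=
  (K ^+ 2)%:C%C * (xi *m energy_mx *m xi^t*) 0 0 * (xi *m xi^t*) 0 0.
Proof.
move=> xL.
have -> : xi *m xi^t* = xi *m gram L phi *m xi^t* by rewrite gram_orthonormal mulmx1.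
have -> : (xi *m energy_mx *m xi^t*) 0 0 =
    (xi *m gram L dphi *m xi^t*) 0 0 + g%:C%C * (xi *m gram L phi *m xi^t*) 0 0.
  by rewrite /energy_mx mulmxDr mulmxDl mxE -scalemxAr -scalemxAl [X in _ + X]mxE.
rewrite gram_at_form !gram_form//.
rewrite -!(rmorphM, rmorphXn, rmorphD) /= lecR.
pose u (i : 'I_M * bool) y :=
  if i.2 then Re (comb phi xi i.1 y) else Im (comb phi xi i.1 y).
pose du (i : 'I_M * bool) y :=
  if i.2 then Re (comb dphi xi i.1 y) else Im (comb dphi xi i.1 y).
have Qu i : Q (u i) (du i) by case: i => j []; [exact: Q_comb_Re|exact: Q_comb_Im].
have sumE (F : 'I_M * bool -> R) : \sum_i F i = \sum_j (F (j, true) + F (j, false)).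
  rewrite (eq_bigr (fun i => F (i.1, i.2))); last by case.
  by rewrite -(pair_bigA _ (fun j b => F (j, b))) /=; apply: eq_bigr => j _; rewrite big_bool.
have HCc j : H1perC L (comb phi xi j) (comb dphi xi j).
  by split; apply: QH; [exact: Q_comb_Re|exact: Q_comb_Im].
have := @cauchy_schwarz_sum R _ (fun i => u i x ^+ 2)
  (fun i => \int[mu]_(y in `[0, L]) (du i y ^+ 2 + g * u i y ^+ 2))
  (fun i => \int[mu]_(y in `[0, L]) (u i y ^+ 2)) K
  (fun i => sqr_ge0 _) (fun i => QE (Qu i))
  (fun i => Rintegral_ge0 _ (fun y _ => sqr_ge0 _)) (fun i => QK (Qu i) xL).
rewrite !sumE /u /du /=.
congr (_ <= _).
- by congr (_ ^+ 2); apply: eq_bigr => j _; rewrite sqr_normcE.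
- congr (_ * _ * _).
    rewrite mulr_sumr -big_split; apply: eq_bigr => j _ /=.
    rewrite (Rintegral_energy _ L0 (QH (Q_comb_Re xi j))).
    rewrite (Rintegral_energy _ L0 (QH (Q_comb_Im xi j))).
    rewrite (Rintegral_sqr_normc (H1perC_L2 (HCc j))).
    rewrite (Rintegral_sqr_normc (H1perC_L2_fun L0 (HCc j))).
    by ring.
  by apply: eq_bigr => j _; rewrite (Rintegral_sqr_normc (H1perC_L2_fun L0 (HCc j))).
Qed.

Lemma gram_at_ccontinuous n m : ccontinuous L (fun x => gram_at phi x n m).
Proof.
have c k j : ccontinuous L (fun x => phi k x j 0) by exact: H1perC_continuous L0 (HC k j).
have := @ccontinuous_sum R L _ (index_enum 'I_M) (fun j x => phi n x j 0 * (phi m x j 0)^*%C)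
  (fun j => ccontinuousM (c n j) (ccontinuousJ (c m j))).
by congr ccontinuous; apply/funext => x; rewrite mxE.
Qed.

Lemma cintegral_gram_at n m : cintegral `[0, L] (fun x => gram_at phi x n m) = gram L phi n m.
Proof.
rewrite mxE -cintegral_sum//; last by move=> j; exact: cintegrable_mulJ.
by apply: eq_cintegral => x _; rewrite mxE.
Qed.

Lemma mxtrace_gram (f : 'I_N -> R -> 'cV[R[i]]_M) : \tr (gram L f) =
  (\sum_n \sum_j \int[mu]_(x in `[0, L]) (Normc.normc (f n x j 0) ^+ 2))%:C%C.
Proof.
rewrite rmorph_sum; apply: eq_bigr => n _; rewrite mxE rmorph_sum.
by apply: eq_bigr => j _; exact: cintegral_mulJ.
Qed.

Lemma trace_inequality :
  cintegral `[0, L] (fun x => \tr (Umx phi x x ^+ 3)) <=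
  (K ^+ 2 * \sum_(n < N) \sum_(j < M) \int[mu]_(x in `[0, L])
     (Normc.normc (dphi n x j 0) ^+ 2 + g * Normc.normc (phi n x j 0) ^+ 2))%:C%C.
Proof.
have mL : measurable `[0, L]%classic by [].
have cA n m := gram_at_ccontinuous n m.
have trE x : \tr (gram_at phi x *m energy_mx) =
    \sum_n \sum_m energy_mx m n * gram_at phi x n m.
  by apply: eq_bigr => n _; rewrite mxE; apply: eq_bigr => m _; rewrite mulrC.
have iA n m : cintegrable `[0, L] (fun x => gram_at phi x n m).
  exact: ccontinuous_integrable.
have isum n : cintegrable `[0, L] (fun x => \sum_m energy_mx m n * gram_at phi x n m).
  by apply: cintegrable_sum => // m; exact: cintegrableZ.
apply: (@le_trans _ _ (cintegral `[0, L]
    (fun x => (K ^+ 2)%:C%C * \sum_n \sum_m energy_mx m n * gram_at phi x n m))).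
  apply: le_cintegral => //.
  - have c3 : ccontinuous L (fun x => \sum_n \sum_m
        (\sum_k gram_at phi x n k * gram_at phi x k m) * gram_at phi x m n).
      apply: ccontinuous_sum => n; apply: ccontinuous_sum => m; apply: ccontinuousM => //.
      by apply: ccontinuous_sum => k; exact: ccontinuousM.
    have := ccontinuous_integrable c3; congr cintegrable; apply/funext => x.
    rewrite mxtrace_Umx; apply: eq_bigr => n _; rewrite mxE; apply: eq_bigr => m _.
    by congr (_ * _); rewrite [RHS]mxE.
  - by apply: cintegrableZ => //; exact: cintegrable_sum.
  - move=> x xL; rewrite mxtrace_Umx -trE; apply: mxtrace_cube_le.
    + exact: gram_at_herm.
    + by move=> xi; rewrite gram_at_form ler0c sumr_ge0// => j _; exact: sqr_ge0.
    + by move=> xi; apply: form_inequality; move: xL; rewrite /= in_itv.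
rewrite cintegralZ//; last exact: cintegrable_sum.
rewrite [leRHS]rmorphM; apply: ler_wpM2l; first by rewrite ler0c sqr_ge0.
rewrite cintegral_sum//.
under eq_bigr => n _.
  rewrite cintegral_sum//; last by move=> m; exact: cintegrableZ.
  under eq_bigr do rewrite cintegralZ// cintegral_gram_at gram_orthonormal mulrC.
  over.
rewrite (_ : \sum_n _ = \tr (1%:M *m energy_mx)); last first.
  by apply: eq_bigr => n _; rewrite mxE.
rewrite mul1mx mxtraceD mxtraceZ !mxtrace_gram -rmorphM -rmorphD /=.
rewrite lecR mulr_sumr -big_split /= ler_sum// => n _.
rewrite mulr_sumr -big_split /= ler_sum// => j _.
have i2 (f : R -> R[i]) : cL2 `[0, L] f ->
    mu.-integrable `[0, L] (EFin \o (fun x => Normc.normc (f x) ^+ 2)).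
  move=> [_ _ fr fi]; have := @integrable_add _ _ _ mu _ mL _ _ fr fi.
  by apply: eq_integrable => // x _ /=; rewrite sqr_normcE.
have j1 := i2 _ (dphi2 n j); have j2 := i2 _ (phi2 n j).
rewrite RintegralD//; last exact: (@integrable_scale _ _ _ mu _ mL).
by rewrite RintegralZl.
Qed.

End trace_inequality.

(* The integral of Tr [U(x,x)^3] is compared with the right-hand side in the
   order of R[i], which includes the claim that it is real. *)
Theorem theorem3p1 (R : realType) (N M : nat) (alpha : R)
    (phi dphi : 'I_N -> R -> 'cV[R[i]]_M)
    (alpha_gt0 : 0 < alpha)
    (phi_H1 : forall (n : 'I_N) (j : 'I_M),
      H1perC (2 * pi / alpha) (fun x => phi n x j 0) (fun x => dphi n x j 0))
    (phi_on : orthonormal_family (2 * pi / alpha) phi) :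
  (forall beta : R, 0 < beta ->
    cintegral `[0, 2 * pi / alpha] (fun x => \tr (Umx phi x x ^+ 3)) <=
    (K1 beta ^+ 2 * \sum_(n < N) \sum_(j < M)
       \int[@lebesgue_measure R]_(x in `[0, 2 * pi / alpha])
         (Normc.normc (dphi n x j 0) ^+ 2
          + alpha ^+ 2 * beta * Normc.normc (phi n x j 0) ^+ 2))%:C%C)
  /\
  (alpha = 1 ->
   (forall (n : 'I_N) (j : 'I_M),
     cintegral `[0, 2 * pi] (fun x => phi n x j 0) = 0) ->
   forall beta : R, 0 <= beta < 1 ->
    cintegral `[0, 2 * pi] (fun x => \tr (Umx phi x x ^+ 3)) <=
    (K2 beta ^+ 2 * \sum_(n < N) \sum_(j < M)
       \int[@lebesgue_measure R]_(x in `[0, 2 * pi])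
         (Normc.normc (dphi n x j 0) ^+ 2
          - beta * Normc.normc (phi n x j 0) ^+ 2))%:C%C).
Proof.
have L0 : 0 <= 2 * pi / alpha by rewrite divr_ge0 ?mulr_ge0 ?pi_ge0// ltW.
split=> [beta b0|a1].
  apply: (@trace_inequality R N M _ _ _ _ _ (H1per (2 * pi / alpha))) => //.
  - exact: H1per_cst.
  - by move=> u v du dv a b; exact: H1per_lin.
  - by move=> n j; case: (phi_H1 n j).
  - by move=> n j; case: (phi_H1 n j).
  - move=> u du _; apply: Rintegral_ge0 => x _.
    by rewrite addr_ge0 ?sqr_ge0// mulr_ge0 ?sqr_ge0// mulr_ge0 ?sqr_ge0 ?(ltW b0).
  - by move=> u du x; exact: K1_bound.
rewrite a1 divr1 in phi_H1 phi_on L0 => phi0 beta b01.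
under eq_bigr do under eq_bigr do under eq_Rintegral do rewrite -mulNr.
apply: (@trace_inequality R N M _ _ _ _ _ (fun u du => H1per (2 * pi) u du /\
    \int[@lebesgue_measure R]_(x in `[0, 2 * pi]) u x = 0)) => //.
- by move=> u du [].
- by split; [exact: H1per_cst|rewrite Rintegral_cst// mul0r].
- move=> u v du dv a b [hu u0] [hv v0]; split; first exact: H1per_lin.
  have iu := H1per_integrable_fun L0 hu; have iv := H1per_integrable_fun L0 hv.
  have mL : measurable `[0, 2 * pi : R]%classic by [].
  rewrite RintegralD//; [|exact: (@integrable_scale _ _ _ lebesgue_measure _ mL)..].
  by rewrite !RintegralZl// u0 v0 !mulr0 addr0.
- by move=> n j; split; [case: (phi_H1 n j)|case: (phi0 n j)].
- by move=> n j; split; [case: (phi_H1 n j)|case: (phi0 n j)].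
- move=> u du [hu u0]; under eq_Rintegral do rewrite mulNr.
  by apply: energy_ge0 => //; case/andP: b01 => -> /ltW.
- move=> u du x [hu u0] xL; under [X in Num.sqrt X]eq_Rintegral do rewrite mulNr.
  exact: K2_bound.
Qed.
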